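(* Let $n\ge2$ be an integer, $\alpha_1,\alpha_2\in[-2(\sqrt2-1),2(\sqrt2-1)]$ and $t\in[0,1]$. For $i=1,2$ let $f_{\alpha_i,n}=h_{\alpha_i,n}+\overline{g_{\alpha_i,n}}$ be a normalized harmonic mapping on $\mathbb{D}$ with $$h_{\alpha_i,n}(z)+g_{\alpha_i,n}(z)=\left(\frac{z\left(\prod_{k=1}^{n-1}(1+z^{2^k})\right)\left(1+z^{2^n}+\alpha_i z^{2^{n-1}}\right)}{1+z^{2^{n+1}}}\right)*\log\frac1{1-z},$$ and suppose that the dilatations of $f_{\alpha_1,n}$ and $f_{\alpha_2,n}$ are $\omega_1(z)=-z^{2^{n-2}}$ and $\omega_2(z)=z^{2^{n-1}}$ respectively. If $\alpha_1\le\alpha_2$, then the convex combination $f=tf_{\alpha_1,n}+(1-t)f_{\alpha_2,n}$ belongs to $\mathcal{S}_H$ and is convex in the direction of the imaginary axis.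
   Context: $\mathbb{D}=\{z\in\mathbb{C}:|z|<1\}$. Harmonic functions on $\mathbb{D}$ are written $f=h+\overline{g}$ with $h,g$ analytic on $\mathbb{D}$; the dilatation is $\omega=g'/h'$. ''Normalized'' means $h(0)=g(0)=0$ and $h'(0)=1$. $\mathcal{S}_H$ is the class of harmonic, sense-preserving, univalent (injective) mappings $f$ on $\mathbb{D}$ with $f(0)=0$, $f_z(0)=1$. The Hadamard product of $\sum_{k\ge1}a_kz^k$ and $\sum_{k\ge1}b_kz^k$ is $\sum_{k\ge1}a_kb_kz^k$. A univalent mapping of $\mathbb{D}$ is convex in the direction of the imaginary axis if the intersection of its image with every vertical line is connected or empty. *)

(* Defs.v *)
From Stdlib Require Import Reals List.
From Coquelicot Require Import Coquelicot.

Open Scope C_scope.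

Definition disc (z : C) : Prop := (Cmod z < 1)%R.

Definition analytic_on_disc (h : C -> C) : Prop :=
  forall z : C, disc z -> ex_derive (K := C_AbsRing) (V := C_NormedModule) h z.

Definition harmonic_map (h g : C -> C) (z : C) : C := h z + Cconj (g z).

Definition normalized_harmonic (h g : C -> C) : Prop :=
  analytic_on_disc h /\ analytic_on_disc g /\
  h 0 = 0 /\ g 0 = 0 /\ C_derive h 0 = 1.

(* w = g'/h', multiplied out so that no value of the quotient at a possible
   zero of h' is involved. *)
Definition is_dilatation (h g w : C -> C) : Prop :=
  forall z : C, disc z -> C_derive g z = w z * C_derive h z.

(* F(z) = sum_{k >= 1} a_k z^k on the disc. *)
Definition disc_expansion (a : nat -> C) (F : C -> C) : Prop :=
  a 0%nat = 0 /\
  forall z : C, disc z ->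
    is_pseries (K := C_AbsRing) (V := C_NormedModule) a z (F z).

(* P = F * G.  The coefficients of F and G are determined by F and G, so P is
   determined on the disc. *)
Definition is_hadamard_product (F G P : C -> C) : Prop :=
  exists a b : nat -> C,
    disc_expansion a F /\ disc_expansion b G /\
    disc_expansion (fun k => a k * b k) P.

(* Principal branch, with values in (-PI, PI]; meaningful for z <> 0. *)
Definition Carg (z : C) : R :=
  if Rle_dec 0 (Im z) then acos (Re z / Cmod z)
  else (- acos (Re z / Cmod z))%R.

Definition Clog (z : C) : C := (ln (Cmod z), Carg z).

Definition Cprod_list (l : list C) : C := fold_right Cmult 1 l.

Definition kernel (n : nat) (alpha : R) (z : C) : C :=
  z * Cprod_list (map (fun k => 1 + z ^ (2 ^ k)) (seq 1 (n - 1)))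
    * (1 + z ^ (2 ^ n) + alpha * z ^ (2 ^ (n - 1)))
    / (1 + z ^ (2 ^ (n + 1))).

Definition partial_x (f : C -> C) (z : C) : C :=
  (Derive (fun x => Re (f (x, Im z))) (Re z),
   Derive (fun x => Im (f (x, Im z))) (Re z)).

Definition partial_y (f : C -> C) (z : C) : C :=
  (Derive (fun y => Re (f (Re z, y))) (Im z),
   Derive (fun y => Im (f (Re z, y))) (Im z)).

(* f_z *)
Definition wirtinger (f : C -> C) (z : C) : C :=
  (partial_x f z - Ci * partial_y f z) / 2.

Definition jacobian (f : C -> C) (z : C) : R :=
  (Re (partial_x f z) * Im (partial_y f z)
   - Re (partial_y f z) * Im (partial_x f z))%R.

Definition harmonic_on_disc (f : C -> C) : Prop :=
  exists h g : C -> C,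
    analytic_on_disc h /\ analytic_on_disc g /\
    forall z : C, disc z -> f z = harmonic_map h g z.

Definition sense_preserving_on_disc (f : C -> C) : Prop :=
  forall z : C, disc z -> (0 < jacobian f z)%R.

Definition univalent_on_disc (f : C -> C) : Prop :=
  forall z w : C, disc z -> disc w -> f z = f w -> z = w.

Definition S_H (f : C -> C) : Prop :=
  harmonic_on_disc f /\ sense_preserving_on_disc f /\ univalent_on_disc f /\
  f 0 = 0 /\ wirtinger f 0 = 1.

(* The empty set is connected in this sense. *)
Definition connected_set (S : C -> Prop) : Prop :=
  forall U V : C -> Prop,
    open U -> open V ->
    (forall w, S w -> U w \/ V w) ->
    (forall w, S w -> ~ (U w /\ V w)) ->
    (exists w, S w /\ U w) -> (exists w, S w /\ V w) -> False.

Definition disc_image (f : C -> C) (w : C) : Prop :=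
  exists z : C, disc z /\ f z = w.

Definition convex_in_imaginary_direction (f : C -> C) : Prop :=
  univalent_on_disc f /\
  forall c : R, connected_set (fun w => disc_image f w /\ Re w = c).

(* Main.v *)
Require Import Defs.
From Stdlib Require Import Reals Ranalysis5 Lra Lia Psatz List ClassicalEpsilon FunctionalExtensionality.
From Coquelicot Require Import Coquelicot.

(* Write [F = h + g] and [K = h - g] for the combined mapping, so that
   [f = Re F + i Im K].  Multiplication of the coefficients by those of
   [log (1 / (1 - z))] turns [z F'] into the kernel, which is affine in [alpha], and
   with [v = z ^ (2 ^ (n - 1))] the product in the kernel telescopes:
     [(1 - z^2) F' = (1 - v^2) (1 + v^2 + alpha v) / (1 + v^4)],
   a function of positive real part which tends to [0] at [z = 1] and [z = -1].
   In the coordinates [z = (x + i y) / (1 + i x y)] on [(-1, 1)^2] this says that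
   [Re F] increases in [x] and that all rows [y = const] have the same range, so each
   level set of [Re F = Re f] is a full graph [x = T y].  Along it [Im f = Im K]
   increases with [y] as soon as the Jacobian [Re (K' conj F') = |h'|^2 - |g'|^2] is
   positive, which gives univalence and makes the vertical sections of the image
   intervals.  Positivity of the Jacobian reduces to that of its cross term, an explicit
   polynomial inequality in [u = z ^ (2 ^ (n - 2))] where [alpha1 <= alpha2] enters. *)

Local Open Scope R_scope.

(** * The polynomial inequalities *)

(* A syntactic match: a bare [apply Rmult_le_pos] would also unfold squares. *)
Ltac mult_nonneg := repeat match goal with |- 0 <= _ * _ => apply Rmult_le_pos end.

Lemma sqr_le_of_between (x y : R) : -y <= x <= y -> x^2 <= y^2.
Proof. intros H. nra. Qed.

(* [829/1000] is an upper bound for [2 * (sqrt 2 - 1)].  If the product of the two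
   linear factors is negative, then both factors are small, so [c^2] stays away
   from [0] and [1] and the last term dominates. *)
Lemma product_term_dominated (rho c a1 a2 : R) :
  2 <= rho -> -1 <= c <= 1 -> -(829/1000) <= a1 -> a1 <= a2 -> a2 <= 829/1000 ->
  0 <= ((rho^2-2)*(2*c^2-1)+a1) * ((rho^2-2)*(2*c^2-1)+a2) * (rho^2-rho*c-2+2*c^2)
       + 4*(a2-a1)*rho^2*(1-c^2)*c^2.
Proof.
  intros HR Hc H1 H12 H2.
  set (X := (rho^2-2)*(2*c^2-1)).
  assert (Hc2 : 0 <= c^2 <= 1) by nra.
  assert (HB : 0 <= rho^2-rho*c-2+2*c^2) by nra.
  assert (HR2 : 4 <= rho^2) by nra.
  destruct (Rle_dec 0 ((X+a1)*(X+a2))) as [HP|HP].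
  - apply Rplus_le_le_0_compat.
    + apply Rmult_le_pos; assumption.
    + mult_nonneg; nra.
  - assert (HX1 : X + a1 < 0) by nra.
    assert (HX2 : 0 < X + a2) by nra.
    (* Opposite signs force [|X| <= 829/1000], and [rho^2 - 2 >= 2] halves the bound. *)
    assert (Hm : (2*c^2-1)^2 <= (829/2000)^2).
    { assert (-(829/1000) <= X <= 829/1000) by lra.
      assert (HXX : X^2 <= (829/1000)^2) by (apply sqr_le_of_between; lra).
      unfold X in HXX. rewrite Rpow_mult_distr in HXX.
      assert (4 <= (rho^2-2)^2) by (assert (2 <= rho^2 - 2) by lra; nra).
      assert (0 <= (2*c^2-1)^2) by apply pow2_ge_0. nra. }
    (* [4*(1-c^2)*c^2] equals [1 - (2*c^2-1)^2]. *)
    assert (Hsc : 828/1000 <= 4*((1-c^2)*c^2)) by nra.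
    (* Completing the square: the product is smallest midway between its two roots. *)
    assert (HPd : - ((X+a1)*(X+a2)) <= (a2-a1)^2/4).
    { assert (0 <= (2*X+a1+a2)^2) by apply pow2_ge_0. nra. }
    assert (HBR : rho^2-rho*c-2+2*c^2 <= 3/2*rho^2) by nra.
    assert (HB2 : - ((X+a1)*(X+a2)) * (rho^2-rho*c-2+2*c^2) <= (a2-a1)^2/4*(3/2*rho^2)).
    { apply Rmult_le_compat; lra. }
    assert (Hd : 0 <= (a2-a1) <= 1658/1000) by lra.
    assert ((a2-a1)*(a2-a1)*rho^2 <= 1658/1000 * (a2-a1)*rho^2).
    { apply Rmult_le_compat_r. lra. nra. }
    assert (828/1000 * ((a2-a1)*rho^2) <= 4*((1-c^2)*c^2) * ((a2-a1)*rho^2)).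
    { apply Rmult_le_compat_r; [nra|lra]. }
    assert (0 <= (a2-a1)*rho^2) by nra.
    (* What remains is [3/8 * 1658/1000 <= 828/1000], times [(a2-a1)*rho^2]. *)
    nra.
Qed.

(** The [2*c*rho] part of the last factor supplies exactly the correction term of
    [product_term_dominated]. What remains is a nonnegative multiple of [B = rho^2-rho*c-2+2*c^2]
    and a term with the sign of [c], so only [c < 0] needs work; there [B >= rho^2/2]. *)
Lemma polar_cross_term_nonneg (rho c a1 a2 : R) :
  2 <= rho -> -1 <= c <= 1 -> -(829/1000) <= a1 -> a1 <= a2 -> a2 <= 829/1000 ->
  0 <= (((rho^2-2)*(2*c^2-1)+a1) * ((rho^2-2)*(2*c^2-1)+a2) + 4*rho^2*(rho^2-4)*(1-c^2)*c^2)
         * (rho^2-rho*c-2+2*c^2)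
       + 2*(a2-a1)*rho*(1-c^2)*c*(rho^2-4+2*c*rho).
Proof.
  intros HR Hc H1 H12 H2.
  assert (C1 := product_term_dominated rho c a1 a2 HR Hc H1 H12 H2).
  assert (Hc2 : 0 <= c^2 <= 1) by nra.
  assert (HR2 : 4 <= rho^2) by nra.
  assert (HB : rho^2/2 <= rho^2-rho*c-2+2*c^2 \/ c > 0).
  { destruct (Rlt_dec 0 c); [right; lra | left; nra]. }
  assert (HB0 : 0 <= rho^2-rho*c-2+2*c^2) by nra.
  set (B := rho^2-rho*c-2+2*c^2) in *.
  set (P := ((rho^2-2)*(2*c^2-1)+a1) * ((rho^2-2)*(2*c^2-1)+a2)) in *.
  assert (HY : 0 <= 4*rho^2*(rho^2-4)*(1-c^2)*c^2).
  { mult_nonneg; nra. }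
  assert (HW : 0 <= rho*(1-c^2)*(rho^2-4)) by (mult_nonneg; nra).
  destruct (Rle_dec 0 c) as [Hc0|Hc0].
  - assert (0 <= 4*rho^2*(rho^2-4)*(1-c^2)*c^2*B) by (apply Rmult_le_pos; assumption).
    assert (0 <= 2*(a2-a1)*c*(rho*(1-c^2)*(rho^2-4))).
    { apply Rmult_le_pos; [|assumption]. mult_nonneg; lra. }
    lra.
  - destruct HB as [HB|HB]; [|lra].
    (* For [c <= -21/100] the term with [4*rho^2*(rho^2-4)] absorbs the negative one, since
       [rho^3 * 21/100 >= 168/100] exceeds [a2 - a1]. For [c] closer to [0] both factors of [P] are
       negative and bounded away from [0], and [P*B] does the absorbing. *)
    destruct (Rle_dec c (-(21/100))) as [Hk|Hk].
    + assert (4*rho^2*(rho^2-4)*(1-c^2)*c^2*(rho^2/2) <= 4*rho^2*(rho^2-4)*(1-c^2)*c^2*B).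
      { apply Rmult_le_compat_l; assumption. }
      assert (0 <= (rho*(1-c^2)*(rho^2-4)) * (-c) * (rho*rho^2*(-c) - (a2-a1))).
      { apply Rmult_le_pos. apply Rmult_le_pos; [assumption|lra].
        assert (2*4 <= rho*rho^2) by (apply Rmult_le_compat; lra).
        assert (2*4*(21/100) <= rho*rho^2*(-c)) by (apply Rmult_le_compat; lra). lra. }
      lra.
    + assert (HX : (rho^2-2)*(2*c^2-1) <= -(91/100)*(rho^2-2)).
      { assert (c^2 <= (21/100)^2) by (apply sqr_le_of_between; lra). nra. }
      assert (HP : (91/100*(rho^2-4)+ 99/100)^2 <= P).
      { unfold P. set (X := (rho^2-2)*(2*c^2-1)) in *.
        assert (91/100*(rho^2-4)+ 99/100 <= -(X+a1)) by lra.
        assert (91/100*(rho^2-4)+ 99/100 <= -(X+a2)) by lra.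
        assert (0 <= 91/100*(rho^2-4)+ 99/100) by lra.
        replace ((X+a1)*(X+a2)) with (-(X+a1)*-(X+a2)) by ring.
        simpl pow at 1. rewrite Rmult_1_r. apply Rmult_le_compat; lra. }
      (* With [D = rho^2-4], the square is at least [4 * (91/100) * (99/100) * D]. *)
      assert (HP2 : (rho^2-4) <= P).
      { apply Rle_trans with (2 := HP). clear - HR2.
        set (D := rho^2-4) in *. assert (0 <= D) by (unfold D; lra). nra. }
      assert ((rho^2-4)*rho <= P*B).
      { apply Rmult_le_compat; try lra. apply Rle_trans with (2 := HB). clear - HR. nra. }
      assert (0 <= 4*(a2-a1)*rho^2*(1-c^2)*c^2) by (mult_nonneg; nra).
      assert (0 <= 4*rho^2*(rho^2-4)*(1-c^2)*c^2*B) by (apply Rmult_le_pos; assumption).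
      assert (2*(a2-a1)*(1-c^2)*(-c) <= 1).
      { assert (Hw1 : (a2-a1)*(-c) <= 1658/1000*(21/100)) by (apply Rmult_le_compat; lra).
        assert (Hw2 : 0 <= (a2-a1)*(-c)) by (apply Rmult_le_pos; lra).
        clear - Hw1 Hw2 Hc2. set (w := (a2-a1)*(-c)) in *.
        replace (2*(a2-a1)*(1-c^2)*(-c)) with (2*(w*(1-c^2))) by (unfold w; ring).
        assert (w*(1-c^2) <= 1658/1000*(21/100)*1) by (apply Rmult_le_compat; lra). lra. }
      assert (0 <= ((rho^2-4)*rho) * (1-2*(a2-a1)*(1-c^2)*(-c))).
      { apply Rmult_le_pos; [apply Rmult_le_pos|]; lra. }
      lra.
Qed.

(* [rho] stands for [r + 1/r], and [(rho^2-2)*(2*c^2-1)] is the real part of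
   [u^2 + u^-2]. *)
Lemma polar_cross_term (r c s a1 a2 : R) : r <> 0 -> s^2 = 1 - c^2 ->
  let u : C := (r*c, r*s) in let rho := (r + / r) in
  Re ((1 + u^4 + a1*u^2) * Cconj (1 + u^4 + a2*u^2) *
         ((1 - Cconj u) * (1 + u^2) * (1 + (r^2)%R * Cconj u)))%C =
  r^6*(1-r^2)*((((rho^2-2)*(2*c^2-1)+a1) * ((rho^2-2)*(2*c^2-1)+a2) + 4*rho^2*(rho^2-4)*(1-c^2)*c^2)
         * (rho^2-rho*c-2+2*c^2)
       + 2*(a2-a1)*rho*(1-c^2)*c*(rho^2-4+2*c*rho)).
Proof.
  intros Hr Hs. cbv zeta.
  unfold Re, Cconj, Cmult, Cplus, Cminus, Copp, RtoC; simpl fst; simpl snd.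
  field [Hs]. exact Hr.
Qed.

Lemma Cmod_lt_1_sqr (u : C) : Cmod u < 1 -> Re u ^ 2 + Im u ^ 2 < 1.
Proof.
  intros Hu. rewrite <- Cmod2_alt. assert (H := Cmod_ge_0 u). nra.
Qed.

(** This is the mixed term of the Jacobian once the denominators [1 - u] and [1 + u^2] are cleared
    through their squared moduli; the last factor is the weight contributed by the dilatations [-u]
    and [u^2]. The polar form involves [1/r], so [u = 0] is separate. *)
Lemma cross_term_nonneg (u : C) (a1 a2 : R) :
  Cmod u < 1 -> -(829/1000) <= a1 -> a1 <= a2 -> a2 <= 829/1000 ->
  0 <= Re ((1 + u^4 + a1*u^2) * Cconj (1 + u^4 + a2*u^2) *
         ((1 - Cconj u) * (1 + u^2) * (1 + (Cmod u ^2)%R * Cconj u)))%C.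
Proof.
  intros Hu H1 H12 H2.
  destruct (Ceq_dec u 0) as [->|Hu0].
  - rewrite Cmod_0.
    unfold Re, Cconj, Cmult, Cplus, Cminus, Copp, RtoC; simpl fst; simpl snd.
    simpl. ring_simplify. lra.
  - apply Cmod_gt_0 in Hu0.
    assert (H := Cmod2_alt u).
    set (r := Cmod u) in *.
    set (c := Re u / r). set (s := Im u / r).
    assert (Hr : r <> 0) by lra.
    assert (Hs : s^2 = 1 - c^2).
    { unfold s, c. field_simplify; try assumption. rewrite H. field_simplify_eq. ring.
      rewrite <- H. apply pow_nonzero; assumption. }
    assert (Eu : u = (r*c, r*s)).
    { destruct u as [x y]. unfold c, s. simpl. f_equal; field; assumption. }
    rewrite Eu. rewrite (polar_cross_term r c s a1 a2 Hr Hs).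
    apply Rmult_le_pos.
    + apply Rmult_le_pos. apply pow_le; lra. nra.
    + apply polar_cross_term_nonneg; try lra.
      * assert (0 < / r) by (apply Rinv_0_lt_compat; lra).
        assert (r * / r = 1) by (field; assumption). nra.
      * assert (0 <= s^2) by apply pow2_ge_0. nra.
Qed.

(** * Modulus estimates and the function of positive real part *)

Lemma Cmod_pow_lt_1 (v : C) (n : nat) : (0 < n)%nat -> Cmod v < 1 -> Cmod (v^n)%C < 1.
Proof.
  intros Hn Hv. rewrite Cmod_pow. apply pow_lt_1_compat; [|assumption].
  split; [apply Cmod_ge_0|assumption].
Qed.

Lemma Cplus_1_neq_0 (v : C) : Cmod v < 1 -> (1 + v)%C <> 0.
Proof.
  intros Hv E. assert (v = - (1))%C as ->.
  { replace v with ((1 + v) - 1)%C by ring. rewrite E. ring. }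
  rewrite Cmod_m1 in Hv. lra.
Qed.

Lemma Cminus_1_neq_0 (v : C) : Cmod v < 1 -> (1 - v)%C <> 0.
Proof.
  intros Hv. apply Cplus_1_neq_0. rewrite Cmod_opp. exact Hv.
Qed.

Lemma Re_Cdiv (a b : C) : b <> 0 -> Re (a / b)%C = Re (a * Cconj b)%C / Cmod b ^ 2.
Proof.
  intros Hb. assert (Hm := Hb). apply Cmod_gt_0 in Hm.
  assert (E : (a / b * (Cmod b ^ 2)%R = a * Cconj b)%C).
  { rewrite Cmod2_conj. field. exact Hb. }
  rewrite <- E, re_scal_r. field. lra.
Qed.

(** After multiplication by the conjugate of [1 + v^4], the real part factors as [1 - |v|^2] times a
    bracket in [x = Re v] and [N = |v|^2], in which only the term with [a*x] can be negative. *)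
Lemma half_plane_pos (v : C) (a : R) :
  Cmod v < 1 -> -(829/1000) <= a <= 829/1000 ->
  0 < Re ((1 - v^2) * (1 + v^2 + a*v) / (1 + v^4))%C.
Proof.
  intros Hv Ha.
  assert (Hb : (1 + v^4)%C <> 0) by (apply Cplus_1_neq_0, Cmod_pow_lt_1; [lia|assumption]).
  rewrite Re_Cdiv by assumption.
  apply Rdiv_lt_0_compat; [|apply pow_lt, Cmod_gt_0, Hb].
  apply Cmod_lt_1_sqr in Hv. destruct v as [x y]. simpl Re in Hv; simpl Im in Hv.
  replace (Re _) with
    ((1-(x^2+y^2))*((1+(x^2+y^2))*(1+(x^2+y^2)^2)
       + a*x*(1+4*(x^2+y^2)+(x^2+y^2)^2-4*x^2))).
  2:{ unfold Re, Cconj, Cmult, Cplus, Cminus, Copp, RtoC; simpl fst; simpl snd. ring. }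
  assert (Hx := pow2_ge_0 x). assert (Hy := pow2_ge_0 y).
  apply Rmult_lt_0_compat; [lra|].
  (* A parabola above [829/1000 * |x|] makes the bound polynomial in [x^2]; [691/1000] approximates
     [(829/1000) / (2 * (3/5))], where the two are closest. *)
  assert (Hax : - (a*x) <= 3/5*x^2 + 3/10).
  { assert (0 <= (Rabs x - 691/1000)^2) by apply pow2_ge_0.
    assert (Rabs x ^ 2 = x^2) by apply pow2_abs.
    assert (-(a*x) <= 829/1000 * Rabs x).
    { eapply Rle_trans. apply Rle_abs. rewrite Rabs_Ropp, Rabs_mult.
      apply Rmult_le_compat_r. apply Rabs_pos. apply Rabs_le; lra. }
    nra. }
  assert (Hwn : x^2 <= x^2+y^2) by lra.
  set (w := x^2) in *. set (N := w + y^2) in *.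
  assert (HF : 0 <= 1+4*N+N^2-4*w) by nra.
  assert (- (a*x) * (1+4*N+N^2-4*w) <= (3/5*w+3/10) * (1+4*N+N^2-4*w)).
  { apply Rmult_le_compat_r; assumption. }
  assert ((3/5*w+3/10) * (1+4*N+N^2-4*w) < (1+N)*(1+N^2)).
  { clear - Hx Hwn Hv HF. clearbody N w. nra. }
  lra.
Qed.

(** As [(1 + v^4) + (1 - v^2) (1 + v^2) = 2], the denominator has modulus at least [1] when
    [|1 - v^2| <= 1/2], while [1 + v^2 + a v] has modulus at most [3]. *)
Lemma half_plane_bound (v : C) (a : R) :
  Cmod v < 1 -> -(829/1000) <= a <= 829/1000 -> Cmod (1 - v^2)%C <= 1/2 ->
  Cmod ((1 - v^2) * (1 + v^2 + a*v) / (1 + v^4))%C <= 3 * Cmod (1 - v^2)%C.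
Proof.
  intros Hv Ha Hs.
  assert (Hb : (1 + v^4)%C <> 0) by (apply Cplus_1_neq_0, Cmod_pow_lt_1; [lia|assumption]).
  rewrite Cmod_div, Cmod_mult by assumption.
  assert (H2 : Cmod (v^2)%C < 1) by (apply Cmod_pow_lt_1; [lia|assumption]).
  assert (H3 : Cmod (1 + v^2 + a*v)%C <= 3).
  { eapply Rle_trans. apply Cmod_triangle.
    assert (H := Cmod_triangle 1 (v^2)%C). rewrite Cmod_1 in H.
    rewrite Cmod_mult, Cmod_R.
    assert (Rabs a <= 829/1000) by (apply Rabs_le; lra).
    assert (K0 := Rabs_pos a). assert (K1 := Cmod_ge_0 v). nra. }
  assert (H4 : 1 <= Cmod (1 + v^4)%C).
  { assert (H := Cmod_triangle (1 + v^4)%C ((1 - v^2) * (1 + v^2))%C).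
    replace (1 + v^4 + (1 - v^2) * (1 + v^2))%C with (RtoC 2) in H by ring.
    rewrite Cmod_R, Rabs_pos_eq, Cmod_mult in H by lra.
    assert (K0 := Cmod_triangle 1 (v^2)%C). rewrite Cmod_1 in K0.
    assert (K1 := Cmod_ge_0 (1 - v^2)%C). assert (H5 := Cmod_ge_0 (1 + v^2)%C). nra. }
  assert (K1 := Cmod_ge_0 (1 - v^2)%C).
  apply Rle_div_l; [lra|].
  assert (Cmod (1 - v ^ 2)%C * Cmod (1 + v ^ 2 + a * v)%C <= Cmod (1 - v ^ 2)%C * 3).
  { apply Rmult_le_compat_l; assumption. }
  nra.
Qed.

Lemma Cmod_1_minus_pow (z : C) (m : nat) :
  Cmod z <= 1 -> Cmod (1 - z^m)%C <= INR m * Cmod (1 - z)%C.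
Proof.
  intros Hz. induction m as [|m IH].
  - replace (1 - z^0)%C with (RtoC 0) by (simpl; ring). rewrite Cmod_0. simpl. lra.
  - rewrite S_INR.
    replace (1 - z ^ S m)%C with ((1 - z) + z * (1 - z^m))%C by (simpl; ring).
    eapply Rle_trans. apply Cmod_triangle. rewrite Cmod_mult.
    assert (H := Cmod_ge_0 (1 - z^m)%C). assert (K0 := Cmod_ge_0 z). nra.
Qed.

(** * Holomorphic functions as real maps *)

Lemma sqrt2_lt_2 : sqrt 2 < 2.
Proof. apply Rsqr_incrst_0; [rewrite Rsqr_sqrt; unfold Rsqr; lra|apply sqrt_pos|lra]. Qed.

Lemma C_derive_domin (f : C -> C) (z : C) (eps : posreal) :
  ex_derive (K := C_AbsRing) (V := C_NormedModule) f z ->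
  locally_2d (fun x y =>
    Cmod (f (x, y) - f z - C_derive f z * ((x, y) - z)) <= eps * Cmod ((x, y) - z)%C)
    (Re z) (Im z).
Proof.
  intros Hf. assert (Hd := C_derive_correct f z 0 Hf).
  destruct Hd as [_ Hd].
  specialize (Hd z (fun P H => H) eps). simpl in Hd.
  destruct Hd as [d Hd].
  (* Since [sqrt 2 < 2], the square of half-side [d / 2] lies in the Euclidean disc of radius
     [d]. *)
  assert (Hd2 : 0 < d / 2) by (destruct d; simpl; lra).
  exists (mkposreal _ Hd2). intros u v Hu Hv. simpl in Hu, Hv.
  assert (Hb : Cmod ((u, v) - z)%C < d).
  { eapply Rle_lt_trans. apply Cmod_2Rmax.
    destruct z as [x y]. simpl in *.
    replace (u + - x) with (u - x) by ring. replace (v + - y) with (v - y) by ring.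
    assert (Rmax (Rabs (u-x)) (Rabs (v-y)) < d / 2) by (apply Rmax_lub_lt; assumption).
    assert (0 <= Rmax (Rabs (u-x)) (Rabs (v-y))).
    { eapply Rle_trans. apply Rabs_pos. apply Rmax_l. }
    assert (Hs2 := sqrt2_lt_2).
    nra. }
  specialize (Hd (u, v) Hb).
  rewrite (Cmult_comm (C_derive f z)). exact Hd.
Qed.

(** The pairs [(1, 0)] and [(0, 1)] for [(a, b)] give the real and the imaginary part. The two
    slopes are the real parts of [(a - i b) f'] and [(a - i b) i f'], which is the Cauchy-Riemann
    relation. *)
Lemma differentiable_real_part_comb (f : C -> C) (x y a b : R) :
  (forall c : C, Rabs (a * Re c + b * Im c) <= Cmod c) ->
  ex_derive (K := C_AbsRing) (V := C_NormedModule) f (x, y) ->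
  let d := C_derive f (x, y) in
  differentiable_pt_lim (fun x y => a * Re (f (x, y)) + b * Im (f (x, y))) x y
    (a * Re d + b * Im d) (b * Re d - a * Im d).
Proof.
  intros Hab Hf d eps.
  assert (He : 0 < eps / 2) by (destruct eps; simpl; lra).
  apply locally_2d_impl with (2 := C_derive_domin f (x, y) (mkposreal _ He) Hf).
  apply locally_2d_forall. intros u v H. simpl pos in H. fold d in H.
  eapply Rle_trans; [|eapply Rle_trans; [exact H|]].
  - eapply Rle_trans; [|apply Hab]. apply Req_le. f_equal.
    destruct d as [d1 d2], (f (u, v)) as [p1 p2], (f (x, y)) as [q1 q2]. simpl. ring.
  - assert (H1 := Cmod_2Rmax ((u, v) - (x, y))%C). simpl fst in H1; simpl snd in H1.
    change (u + - x) with (u - x) in H1. change (v + - y) with (v - y) in H1.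
    assert (H0 : 0 <= Rmax (Rabs (u-x)) (Rabs (v-y))).
    { eapply Rle_trans. apply Rabs_pos. apply Rmax_l. }
    assert (Hs2 := sqrt2_lt_2).
    assert (H3 : Cmod ((u, v) - (x, y))%C <= 2 * Rmax (Rabs (u - x)) (Rabs (v - y))) by nra.
    assert (eps / 2 * Cmod ((u, v) - (x, y))%C <= eps / 2 * (2 * Rmax (Rabs (u - x)) (Rabs (v - y)))).
    { apply Rmult_le_compat_l; lra. }
    lra.
Qed.

Lemma differentiable_Re (f : C -> C) (x y : R) :
  ex_derive (K := C_AbsRing) (V := C_NormedModule) f (x, y) ->
  differentiable_pt_lim (fun x y => Re (f (x, y))) x y
    (Re (C_derive f (x, y))) (- Im (C_derive f (x, y))).
Proof.
  intros Hf. assert (H := differentiable_real_part_comb f x y 1 0).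
  cbv zeta in H. replace (Re _) with (1 * Re (C_derive f (x, y)) + 0 * Im (C_derive f (x, y))) by ring.
  replace (- _) with (0 * Re (C_derive f (x, y)) - 1 * Im (C_derive f (x, y))) by ring.
  eapply differentiable_pt_lim_ext; [|apply H; [|exact Hf]].
  - apply locally_2d_forall. intros u v. ring.
  - intros c. replace (1 * Re c + 0 * Im c) with (Re c) by ring. apply re_le_Cmod.
Qed.

Lemma differentiable_Im (f : C -> C) (x y : R) :
  ex_derive (K := C_AbsRing) (V := C_NormedModule) f (x, y) ->
  differentiable_pt_lim (fun x y => Im (f (x, y))) x y
    (Im (C_derive f (x, y))) (Re (C_derive f (x, y))).
Proof.
  intros Hf. assert (H := differentiable_real_part_comb f x y 0 1).
  cbv zeta in H. replace (Im _) with (0 * Re (C_derive f (x, y)) + 1 * Im (C_derive f (x, y))) by ring.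
  replace (Re _) with (1 * Re (C_derive f (x, y)) - 0 * Im (C_derive f (x, y))) at 2 by ring.
  eapply differentiable_pt_lim_ext; [|apply H; [|exact Hf]].
  - apply locally_2d_forall. intros u v. ring.
  - intros c. replace (0 * Re c + 1 * Im c) with (Im c) by ring.
    eapply Rle_trans; [|apply Rmax_Cmod]. apply Rmax_r.
Qed.

Lemma differentiable_mult (f g : R -> R -> R) (x y fx fy gx gy : R) :
  differentiable_pt_lim f x y fx fy -> differentiable_pt_lim g x y gx gy ->
  differentiable_pt_lim (fun u v => f u v * g u v) x y
    (g x y * fx + f x y * gx) (g x y * fy + f x y * gy).
Proof.
  intros Hf Hg. apply (differentiable_pt_lim_comp Rmult f g); try assumption.
  intros eps. exists eps. intros u v Hu Hv.
  replace (u * v - f x y * g x y - (g x y * (u - f x y) + f x y * (v - g x y)))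
    with ((u - f x y) * (v - g x y)) by ring.
  rewrite Rabs_mult. apply Rmult_le_compat; try apply Rabs_pos. lra. apply Rmax_r.
Qed.

Lemma differentiable_fst (f : R -> R) (x y l : R) :
  is_derive f x l -> differentiable_pt_lim (fun u _ => f u) x y l 0.
Proof. intros H. apply differentiable_pt_lim_proj1_0, is_derive_Reals, H. Qed.

Lemma differentiable_snd (f : R -> R) (x y l : R) :
  is_derive f y l -> differentiable_pt_lim (fun _ v => f v) x y 0 l.
Proof.
  intros H eps.
  destruct (differentiable_fst f y x l H eps) as [d Hd].
  exists d. intros u v Hu Hv. specialize (Hd v u Hv Hu).
  rewrite Rmax_comm.
  replace (0 * (u - x) + l * (v - y)) with (l * (v - y) + 0 * (u - x)) by ring. exact Hd.
Qed.

Lemma differentiable_comp1 (g : R -> R) (f : R -> R -> R) (x y l fx fy : R) :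
  is_derive g (f x y) l -> differentiable_pt_lim f x y fx fy ->
  differentiable_pt_lim (fun u v => g (f u v)) x y (l * fx) (l * fy).
Proof.
  intros Hg Hf.
  replace (l * fx) with (l * fx + 0 * fx) by ring.
  replace (l * fy) with (l * fy + 0 * fy) by ring.
  apply (differentiable_pt_lim_comp (fun u _ => g u) f f); try assumption.
  apply differentiable_fst, Hg.
Qed.

(** * Level curves on a square *)

(** An implicit function theorem at one point. The linearization of [U] along the level set, with
    error [a/2], first upgrades continuity of [T] to a Lipschitz bound at [y]; this bound then turns
    an error small relative to both increments into one small relative to that of [y]. *)
Lemma derivable_pt_lim_implicit (U : R -> R -> R) (T : R -> R) (y a b : R) :
  differentiable_pt_lim U (T y) y a b -> 0 < a -> continuity_pt T y ->
  locally y (fun v => U (T v) v = U (T y) y) ->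
  derivable_pt_lim T y (- b / a).
Proof.
  intros HU Ha HT Hlev.
  assert (Hsmall : forall e : posreal, locally y (fun v =>
    Rabs (a * (T v - T y) + b * (v - y)) <= e * Rmax (Rabs (T v - T y)) (Rabs (v - y)))).
  { intros e. destruct (HU e) as [d Hd].
    assert (HTd := proj1 (continuity_pt_locally _ _) HT d). assert (Hyd : locally y (fun v => Rabs (v - y) < d)).
    { exists d. intros v Hv. exact Hv. }
    generalize (filter_and _ _ Hlev (filter_and _ _ HTd Hyd)).
    apply filter_imp. intros v (H1 & H2 & H3).
    specialize (Hd (T v) v H2 H3). rewrite H1 in Hd.
    replace (U (T y) y - U (T y) y - (a * (T v - T y) + b * (v - y)))
      with (- (a * (T v - T y) + b * (v - y))) in Hd by ring.
    rewrite Rabs_Ropp in Hd. exact Hd. }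
  (* The Lipschitz constant solves [a/2 * |dT| <= (|b| + a/2) * |dy|]. *)
  set (K := 2 * Rabs b / a + 1).
  assert (HK : 1 <= K).
  { unfold K. assert (0 <= 2 * Rabs b / a); [|lra].
    apply Rdiv_le_0_compat; [|assumption]. assert (H := Rabs_pos b). lra. }
  assert (Ha2 : 0 < a / 2) by lra.
  assert (Hlip : locally y (fun v => Rabs (T v - T y) <= K * Rabs (v - y))).
  { generalize (Hsmall (mkposreal _ Ha2)). apply filter_imp. simpl. intros v Hv.
    assert (H1 : Rabs (a * (T v - T y)) <=
       Rabs (a * (T v - T y) + b * (v - y)) + Rabs (b * (v - y))).
    { replace (a * (T v - T y)) with
        ((a * (T v - T y) + b * (v - y)) + - (b * (v - y))) at 1 by ring.
      eapply Rle_trans. apply Rabs_triang. rewrite Rabs_Ropp. lra. }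
    rewrite !Rabs_mult, (Rabs_pos_eq a) in H1 by lra.
    assert (H2 : Rmax (Rabs (T v - T y)) (Rabs (v - y)) <= Rabs (T v - T y) + Rabs (v - y)).
    { assert (H3 := Rabs_pos (T v - T y)). assert (H4 := Rabs_pos (v - y)).
      apply Rmax_lub; lra. }
    assert (H3 : a / 2 * Rabs (T v - T y) <= (Rabs b + a / 2) * Rabs (v - y)) by nra.
    replace (K * Rabs (v - y)) with (2 / a * ((Rabs b + a / 2) * Rabs (v - y))).
    2:{ unfold K. field. lra. }
    replace (Rabs (T v - T y)) with (2 / a * (a / 2 * Rabs (T v - T y))) at 1 by (field; lra).
    apply Rmult_le_compat_l; [|exact H3]. apply Rdiv_le_0_compat; lra. }
  intros e He.
  assert (He' : 0 < e * a / (2 * K)).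
  { apply Rdiv_lt_0_compat; [apply Rmult_lt_0_compat; assumption|lra]. }
  destruct (filter_and _ _ Hlip (Hsmall (mkposreal _ He'))) as [d Hd].
  exists d. intros h Hh Hhd.
  destruct (Hd (y + h)) as [H1 H2].
  { change (Rabs (y + h - y) < d). replace (y + h - y) with h by ring. exact Hhd. }
  simpl in H2. replace (y + h - y) with h in H1, H2 by ring.
  assert (Hh0 := Rabs_pos_lt h Hh).
  assert (H3 : Rmax (Rabs (T (y + h) - T y)) (Rabs h) <= K * Rabs h).
  { apply Rmax_lub; [assumption|nra]. }
  replace ((T (y + h) - T y) / h - - b / a)
    with ((a * (T (y + h) - T y) + b * h) * / (a * h)) by (field; lra).
  rewrite Rabs_mult, Rabs_inv, Rabs_mult, (Rabs_pos_eq a) by lra.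
  apply Rlt_div_l. apply Rmult_lt_0_compat; lra.
  apply Rle_lt_trans with (e * a / (2 * K) * (K * Rabs h)).
  - eapply Rle_trans. exact H2. apply Rmult_le_compat_l; lra.
  - replace (e * a / (2 * K) * (K * Rabs h)) with (e * (a * Rabs h) / 2) by (field; lra).
    assert (0 < e * (a * Rabs h)) by (repeat apply Rmult_lt_0_compat; assumption). lra.
Qed.

Definition square_gradient (U Ux Uy : R -> R -> R) : Prop :=
  forall x y, -1 < x < 1 -> -1 < y < 1 -> differentiable_pt_lim U x y (Ux x y) (Uy x y).

Lemma square_gradient_x (U Ux Uy : R -> R -> R) (x y : R) :
  square_gradient U Ux Uy -> -1 < x < 1 -> -1 < y < 1 ->
  is_derive (fun u => U u y) x (Ux x y).
Proof.
  intros HU Hx Hy. apply is_derive_Reals.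
  replace (Ux x y) with (Ux x y * 1 + Uy x y * 0) by ring.
  apply (derivable_pt_lim_comp_2d U (fun u => u) (fun _ => y)).
  - apply HU; assumption.
  - apply derivable_pt_lim_id.
  - apply derivable_pt_lim_const.
Qed.

Lemma square_gradient_y (U Ux Uy : R -> R -> R) (x y : R) :
  square_gradient U Ux Uy -> -1 < x < 1 -> -1 < y < 1 ->
  is_derive (fun v => U x v) y (Uy x y).
Proof.
  intros HU Hx Hy. apply is_derive_Reals.
  replace (Uy x y) with (Ux x y * 0 + Uy x y * 1) by ring.
  apply (derivable_pt_lim_comp_2d U (fun _ => x) (fun v => v)).
  - apply HU; assumption.
  - apply derivable_pt_lim_const.
  - apply derivable_pt_lim_id.
Qed.

Lemma is_derive_continuity_pt (f : R -> R) (x l : R) : is_derive f x l -> continuity_pt f x.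
Proof.
  intros H. apply derivable_continuous_pt. exists l. apply is_derive_Reals, H.
Qed.

Lemma square_increasing (U Ux Uy : R -> R -> R) (x1 x2 y : R) :
  square_gradient U Ux Uy ->
  (forall x y, -1 < x < 1 -> -1 < y < 1 -> 0 < Ux x y) ->
  -1 < x1 -> x1 < x2 -> x2 < 1 -> -1 < y < 1 -> U x1 y < U x2 y.
Proof.
  intros HU Hpos H1 H12 H2 Hy.
  apply (incr_function (fun x => U x y) (-1) 1 (fun x => Ux x y)); simpl; try assumption.
  - intros x Hx1 Hx2. eapply square_gradient_x; eauto.
  - intros x Hx1 Hx2. apply Hpos; auto.
Qed.

Lemma square_y_variation (U Ux Uy : R -> R -> R) (x y1 y2 e : R) :
  square_gradient U Ux Uy -> -1 < x < 1 -> -1 < y1 < 1 -> -1 < y2 < 1 ->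
  (forall y, -1 < y < 1 -> Rabs (Uy x y) <= e) -> Rabs (U x y2 - U x y1) <= 2 * e.
Proof.
  intros HU Hx H1 H2 He.
  assert (Hin : forall z, Rmin y1 y2 <= z <= Rmax y1 y2 -> -1 < z < 1).
  { intros z. unfold Rmin, Rmax. destruct (Rle_dec y1 y2); lra. }
  destruct (MVT_gen (fun y => U x y) y1 y2 (fun y => Uy x y)) as [z [Hz E]].
  - intros z Hz. eapply square_gradient_y; eauto. apply Hin. lra.
  - intros z Hz. eapply is_derive_continuity_pt. eapply square_gradient_y; eauto.
  - rewrite E, Rabs_mult. rewrite (Rmult_comm 2).
    apply Rmult_le_compat; try apply Rabs_pos. apply He, Hin, Hz. apply Rabs_le. lra.
Qed.

(* The condition on [Uy] makes all rows [U . y] share the same limits at both ends. *)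
Lemma square_level_full (U Ux Uy : R -> R -> R) (x0 y0 y : R) :
  square_gradient U Ux Uy ->
  (forall x y, -1 < x < 1 -> -1 < y < 1 -> 0 < Ux x y) ->
  (forall e, 0 < e -> exists d, 0 < d /\
     forall x y, -1 < x < 1 -> 1 - d < Rabs x -> -1 < y < 1 -> Rabs (Uy x y) <= e) ->
  -1 < x0 < 1 -> -1 < y0 < 1 -> -1 < y < 1 ->
  exists x, -1 < x < 1 /\ U x y = U x0 y0.
Proof.
  intros HU Hpos Hlim Hx0 Hy0 Hy.
  set (c := U x0 y0).
  (* Moving right along row [y0] opens a gap above [c]; far enough right, passing to row [y] costs
     at most half of that gap. *)
  assert (Hr : exists x, -1 < x < 1 /\ x0 < x /\ c < U x y).
  { assert (Hgap : c < U ((x0 + 1) / 2) y0) by (eapply square_increasing; eauto; lra).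
    destruct (Hlim ((U ((x0 + 1) / 2) y0 - c) / 4)) as (d & Hd & H); [lra|].
    set (x := Rmax ((x0 + 1) / 2) (1 - d / 2)).
    assert (Hx1 : (x0 + 1) / 2 <= x) by apply Rmax_l.
    assert (Hx2 : 1 - d / 2 <= x) by apply Rmax_r.
    assert (Hx3 : x < 1) by (apply Rmax_lub_lt; lra).
    exists x. split; [lra|]. split; [lra|].
    assert (Hv := square_y_variation U Ux Uy x y0 y ((U ((x0 + 1) / 2) y0 - c) / 4) HU).
    assert (Hle : U ((x0 + 1) / 2) y0 <= U x y0).
    { destruct Hx1 as [Hx1| <-]; [left; eapply square_increasing; eauto; lra|lra]. }
    assert (Hv2 : Rabs (U x y - U x y0) <= 2 * ((U ((x0 + 1) / 2) y0 - c) / 4)).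
    { apply Hv; try lra. intros z Hz. apply H; try lra.
      eapply Rlt_le_trans; [|apply Rle_abs]. lra. }
    apply Rabs_le_between in Hv2. lra. }
  assert (Hl : exists x, -1 < x < 1 /\ x < x0 /\ U x y < c).
  { assert (Hgap : U ((x0 - 1) / 2) y0 < c) by (eapply square_increasing; eauto; lra).
    destruct (Hlim ((c - U ((x0 - 1) / 2) y0) / 4)) as (d & Hd & H); [lra|].
    set (x := Rmin ((x0 - 1) / 2) (d / 2 - 1)).
    assert (Hx1 : x <= (x0 - 1) / 2) by apply Rmin_l.
    assert (Hx2 : x <= d / 2 - 1) by apply Rmin_r.
    assert (Hx3 : -1 < x) by (apply Rmin_glb_lt; lra).
    exists x. split; [lra|]. split; [lra|].
    assert (Hv := square_y_variation U Ux Uy x y0 y ((c - U ((x0 - 1) / 2) y0) / 4) HU).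
    assert (Hle : U x y0 <= U ((x0 - 1) / 2) y0).
    { destruct Hx1 as [Hx1| ->]; [left; eapply square_increasing; eauto; lra|lra]. }
    assert (Hv2 : Rabs (U x y - U x y0) <= 2 * ((c - U ((x0 - 1) / 2) y0) / 4)).
    { apply Hv; try lra. intros z Hz. apply H; try lra.
      rewrite <- Rabs_Ropp. eapply Rlt_le_trans; [|apply Rle_abs]. lra. }
    apply Rabs_le_between in Hv2. lra. }
  destruct Hr as (xr & Hxr & Hxr0 & Hr). destruct Hl as (xl & Hxl & Hxl0 & Hl).
  destruct (IVT_interv (fun x => U x y - c) xl xr) as (x & Hx & E); try lra.
  - intros x Hx. apply continuity_pt_minus.
    + eapply is_derive_continuity_pt. eapply square_gradient_x; eauto. lra.
    + apply continuity_pt_const. intros ? ?. reflexivity.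
  - exists x. split; lra.
Qed.

(** Each row meets the level exactly once, at [T y]. Continuity of [T] comes from trapping the level
    between the values of [U] at [T y - r] and [T y + r] on nearby rows. Then [T' = - Uy / Ux], and
    [V] has derivative [(Ux Vy - Uy Vx) / Ux] along the curve. *)
Lemma square_level_curve (U Ux Uy V Vx Vy : R -> R -> R) (x0 y0 : R) :
  square_gradient U Ux Uy -> square_gradient V Vx Vy ->
  (forall x y, -1 < x < 1 -> -1 < y < 1 -> 0 < Ux x y) ->
  (forall x y, -1 < x < 1 -> -1 < y < 1 -> 0 < Ux x y * Vy x y - Uy x y * Vx x y) ->
  (forall e, 0 < e -> exists d, 0 < d /\
     forall x y, -1 < x < 1 -> 1 - d < Rabs x -> -1 < y < 1 -> Rabs (Uy x y) <= e) ->
  -1 < x0 < 1 -> -1 < y0 < 1 ->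
  exists T : R -> R, forall y, -1 < y < 1 ->
    -1 < T y < 1 /\ U (T y) y = U x0 y0 /\
    exists l, 0 < l /\ is_derive (fun v => V (T v) v) y l.
Proof.
  intros HU HV Hpos HJ Hlim Hx0 Hy0.
  set (c := U x0 y0).
  (* The [0] witnesses that the reals are inhabited; nothing is claimed about [T y] for [y] outside
     the interval. *)
  set (T := fun y => epsilon (inhabits 0) (fun x => -1 < x < 1 /\ U x y = c)).
  assert (HT : forall y, -1 < y < 1 -> -1 < T y < 1 /\ U (T y) y = c).
  { intros y Hy. apply (epsilon_spec (inhabits 0) (fun x => -1 < x < 1 /\ U x y = c)).
    eapply square_level_full; eauto. }
  exists T. intros y Hy. destruct (HT y Hy) as [HTy E]. split; [exact HTy|]. split; [exact E|].
  assert (Hnear : locally y (fun v => -1 < v < 1)).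
  { apply (locally_interval _ y (-1) 1); simpl; try lra. intros v H1 H2. lra. }
  assert (HTc : continuity_pt T y).
  { apply continuity_pt_locally. intros e.
    (* The last two bounds keep [T y - r] and [T y + r] inside the square. *)
    set (r := Rmin (e / 2) (Rmin ((1 - T y) / 2) ((1 + T y) / 2))).
    assert (He := cond_pos e).
    assert (Hr : 0 < r) by (unfold r; repeat apply Rmin_glb_lt; lra).
    assert (Hr1 : r <= e / 2) by apply Rmin_l.
    assert (Hr2 : r <= (1 - T y) / 2).
    { unfold r. eapply Rle_trans. apply Rmin_r. apply Rmin_l. }
    assert (Hr3 : r <= (1 + T y) / 2).
    { unfold r. eapply Rle_trans. apply Rmin_r. apply Rmin_r. }
    assert (Hup : c < U (T y + r) y).
    { rewrite <- E. eapply square_increasing; eauto; lra. }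
    assert (Hdn : U (T y - r) y < c).
    { rewrite <- E. eapply square_increasing; eauto; lra. }
    assert (Cup : continuity_pt (fun v => U (T y + r) v) y).
    { eapply is_derive_continuity_pt, square_gradient_y; eauto. lra. }
    assert (Cdn : continuity_pt (fun v => U (T y - r) v) y).
    { eapply is_derive_continuity_pt, square_gradient_y; eauto. lra. }
    assert (Eup : 0 < U (T y + r) y - c) by lra.
    assert (Edn : 0 < c - U (T y - r) y) by lra.
    assert (Lup := proj1 (continuity_pt_locally _ _) Cup (mkposreal _ Eup)).
    assert (Ldn := proj1 (continuity_pt_locally _ _) Cdn (mkposreal _ Edn)).
    generalize (filter_and _ _ Hnear (filter_and _ _ Lup Ldn)).
    apply filter_imp. simpl. intros v (Hv & Hv1 & Hv2).
    apply Rabs_lt_between in Hv1. apply Rabs_lt_between in Hv2.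
    destruct (HT v Hv) as [HTv Ev].
    assert (T v < T y + r).
    { destruct (Rlt_dec (T v) (T y + r)) as [H|H]; [exact H|exfalso].
      destruct (Rle_lt_or_eq_dec (T y + r) (T v)) as [H1|H1]; [lra| |].
      - assert (U (T y + r) v < U (T v) v) by (eapply square_increasing; eauto; lra). lra.
      - rewrite <- H1 in Ev. lra. }
    assert (T y - r < T v).
    { destruct (Rlt_dec (T y - r) (T v)) as [H1|H1]; [exact H1|exfalso].
      destruct (Rle_lt_or_eq_dec (T v) (T y - r)) as [H2|H2]; [lra| |].
      - assert (U (T v) v < U (T y - r) v) by (eapply square_increasing; eauto; lra). lra.
      - rewrite H2 in Ev. lra. }
    apply Rabs_lt_between. lra. }
  assert (HTd : derivable_pt_lim T y (- Uy (T y) y / Ux (T y) y)).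
  { apply derivable_pt_lim_implicit with (U := U); auto.
    generalize Hnear. apply filter_imp. intros v Hv. rewrite E. apply HT, Hv. }
  exists (Vx (T y) y * (- Uy (T y) y / Ux (T y) y) + Vy (T y) y * 1). split.
  - assert (H1 := Hpos (T y) y HTy Hy). assert (H2 := HJ (T y) y HTy Hy).
    replace (Vx (T y) y * (- Uy (T y) y / Ux (T y) y) + Vy (T y) y * 1)
      with ((Ux (T y) y * Vy (T y) y - Uy (T y) y * Vx (T y) y) / Ux (T y) y) by (field; lra).
    apply Rdiv_lt_0_compat; assumption.
  - apply is_derive_Reals. apply (derivable_pt_lim_comp_2d V T (fun v => v)).
    + apply HV; assumption.
    + exact HTd.
    + apply derivable_pt_lim_id.
Qed.

(** * Bipolar coordinates on the disc *)

(** Along the curve the indicator of [U] is locally constant, because both sets are open and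
    separate [S]. Its derivative is therefore [0], and the mean value theorem forbids it to take
    both values [1] and [0]. *)
Lemma connected_graph (S : C -> Prop) (c : R) (W : R -> R) :
  (forall w, S w <-> exists y, -1 < y < 1 /\ w = (c, W y)) ->
  (forall y, -1 < y < 1 -> continuity_pt W y) ->
  connected_set S.
Proof.
  intros HS HW U V HU HV Hcov Hdis [w1 [Hw1 HU1]] [w2 [Hw2 HV2]].
  set (ind := fun y => if excluded_middle_informative (U (c, W y)) then 1 else 0).
  assert (Hopen : forall (O : C -> Prop) y, open O -> -1 < y < 1 -> O (c, W y) ->
    locally y (fun v => -1 < v < 1 /\ O (c, W v))).
  { intros O y HO Hy Hin. destruct (HO _ Hin) as [e He].
    assert (Hnear : locally y (fun v => -1 < v < 1)).
    { apply (locally_interval _ y (-1) 1); simpl; try lra. intros v H1 H2. lra. }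
    generalize (filter_and _ _ Hnear (proj1 (continuity_pt_locally _ _) (HW y Hy) e)).
    apply filter_imp. intros v [Hv1 Hv2]. split; [exact Hv1|]. apply He. split; simpl.
    - apply ball_center.
    - exact Hv2. }
  assert (Hd : forall y, -1 < y < 1 -> is_derive ind y 0).
  { intros y Hy.
    destruct (Hcov (c, W y)) as [H|H].
    { apply HS. exists y. split; auto. }
    - apply is_derive_ext_loc with (fun _ => 1); [|apply is_derive_Reals, derivable_pt_lim_const].
      generalize (Hopen U y HU Hy H). apply filter_imp. intros v [Hv HvU]. unfold ind.
      destruct (excluded_middle_informative _); [reflexivity|contradiction].
    - apply is_derive_ext_loc with (fun _ => 0); [|apply is_derive_Reals, derivable_pt_lim_const].
      generalize (Hopen V y HV Hy H). apply filter_imp. intros v [Hv HvV]. unfold ind.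
      destruct (excluded_middle_informative _) as [HvU|]; [|reflexivity].
      exfalso. apply (Hdis (c, W v)); [|split; assumption]. apply HS. exists v. split; auto. }
  apply HS in Hw1. apply HS in Hw2.
  destruct Hw1 as (y1 & Hy1 & ->). destruct Hw2 as (y2 & Hy2 & E2).
  assert (Hin : forall z, Rmin y1 y2 <= z <= Rmax y1 y2 -> -1 < z < 1).
  { intros z. unfold Rmin, Rmax. destruct (Rle_dec y1 y2); lra. }
  destruct (MVT_gen ind y1 y2 (fun _ => 0)) as [z [_ E]].
  - intros z Hz. apply Hd, Hin. lra.
  - intros z Hz. eapply is_derive_continuity_pt. apply Hd, Hin, Hz.
  - unfold ind in E.
    destruct (excluded_middle_informative (U (c, W y1))) as [_|]; [|contradiction].
    destruct (excluded_middle_informative (U (c, W y2))) as [H|_]; [|lra].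
    apply (Hdis w2); [apply HS; exists y2; auto|]. split; [rewrite E2; exact H|exact HV2].
Qed.

(* The coordinates [z = (x + i y) / (1 + i x y)], i.e. [x = tanh a], [y = tan b]
   where [a + i b = log ((1 + z) / (1 - z)) / 2]. *)
Definition bipolar_re (x y : R) : R := x * (1 + y^2) * / (1 + x^2 * y^2).
Definition bipolar_im (x y : R) : R := y * (1 - x^2) * / (1 + x^2 * y^2).
(** This is [1 / (1 + i x y)^2]: the coordinate map has [dz/dx = (1 + y^2) * factor] and
    [dz/dy = i (1 - x^2) * factor]. *)
Definition bipolar_factor (x y : R) : C :=
  ((1 - x^2 * y^2) / (1 + x^2 * y^2)^2, - (2 * x * y) / (1 + x^2 * y^2)^2).

Lemma sqr_lt_1 (x : R) : -1 < x < 1 -> x^2 < 1.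
Proof. intros H. assert (0 < (1 - x) * (1 + x)) by (apply Rmult_lt_0_compat; lra). lra. Qed.

Lemma bipolar_denom_pos (x y : R) : 0 < 1 + x^2 * y^2.
Proof. assert (H := pow2_ge_0 x). assert (H1 := pow2_ge_0 y). nra. Qed.

Lemma differentiable_pt_lim_eq (f : R -> R -> R) (x y a b a' b' : R) :
  a = a' -> b = b' -> differentiable_pt_lim f x y a b -> differentiable_pt_lim f x y a' b'.
Proof. intros -> ->. exact (fun H => H). Qed.

Lemma differentiable_bipolar_denom (x y : R) :
  differentiable_pt_lim (fun x y => / (1 + x^2 * y^2)) x y
    (- (2 * x * y^2) / (1 + x^2 * y^2)^2) (- (2 * x^2 * y) / (1 + x^2 * y^2)^2).
Proof.
  assert (H := bipolar_denom_pos x y).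
  eapply differentiable_pt_lim_eq;
    [| |apply (differentiable_comp1 (fun s => / (1 + s)) (fun x y => x^2 * y^2));
        [|apply (differentiable_mult (fun x _ => x^2) (fun _ y => y^2));
          [apply (differentiable_fst (fun x => x^2))|apply (differentiable_snd (fun x => x^2))]]].
  4: auto_derive; [exact I|reflexivity].
  4: auto_derive; [exact I|reflexivity].
  3: auto_derive; [lra|reflexivity].
  all: simpl; field; lra.
Qed.

Lemma differentiable_bipolar_re (x y : R) :
  differentiable_pt_lim bipolar_re x y
    ((1 + y^2) * Re (bipolar_factor x y)) (- (1 - x^2) * Im (bipolar_factor x y)).
Proof.
  assert (H := bipolar_denom_pos x y).
  eapply differentiable_pt_lim_eq;
    [| |apply (differentiable_mult (fun x y => x * (1 + y^2)) (fun x y => / (1 + x^2 * y^2)));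
        [apply (differentiable_mult (fun x _ => x) (fun _ y => 1 + y^2));
          [apply (differentiable_fst (fun x => x))|apply (differentiable_snd (fun y => 1 + y^2))]
        |apply differentiable_bipolar_denom]].
  3: auto_derive; [exact I|reflexivity].
  3: auto_derive; [exact I|reflexivity].
  all: simpl; field; lra.
Qed.

Lemma differentiable_bipolar_im (x y : R) :
  differentiable_pt_lim bipolar_im x y
    ((1 + y^2) * Im (bipolar_factor x y)) ((1 - x^2) * Re (bipolar_factor x y)).
Proof.
  assert (H := bipolar_denom_pos x y).
  eapply differentiable_pt_lim_eq;
    [| |apply (differentiable_mult (fun x y => y * (1 - x^2)) (fun x y => / (1 + x^2 * y^2)));
        [apply (differentiable_mult (fun _ y => y) (fun x _ => 1 - x^2));
          [apply (differentiable_snd (fun x => x))|apply (differentiable_fst (fun y => 1 - y^2))]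
        |apply differentiable_bipolar_denom]].
  3: auto_derive; [exact I|reflexivity].
  3: auto_derive; [exact I|reflexivity].
  all: simpl; field; lra.
Qed.

(** Hence [dz/dx] and [dz/dy] are real multiples of [1 - z^2] and [i (1 - z^2)], and [(1 - z^2) F']
    controls both partial derivatives of [Re F]. *)
Lemma bipolar_one_minus_sqr (x y : R) :
  (1 - Cpow (bipolar_re x y, bipolar_im x y) 2)%C = (((1 - x^2) * (1 + y^2))%R * bipolar_factor x y)%C.
Proof.
  assert (H := bipolar_denom_pos x y).
  unfold bipolar_re, bipolar_im, bipolar_factor.
  apply injective_projections; simpl; field; lra.
Qed.

Lemma bipolar_factor_Cmod (x y : R) : Re (bipolar_factor x y)^2 + Im (bipolar_factor x y)^2 = / (1 + x^2 * y^2)^2.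
Proof.
  assert (H := bipolar_denom_pos x y).
  unfold bipolar_factor; simpl; field; lra.
Qed.

Lemma bipolar_disc (x y : R) : -1 < x < 1 -> -1 < y < 1 -> Defs.disc (bipolar_re x y, bipolar_im x y).
Proof.
  intros Hx Hy. assert (H := bipolar_denom_pos x y). unfold disc.
  assert (Hlt : Cmod (bipolar_re x y, bipolar_im x y)^2 < 1^2).
  { rewrite Cmod2_alt. simpl Re; simpl Im.
    assert (E : 1 - (bipolar_re x y ^2 + bipolar_im x y^2) = (1 - x^2) * (1 - y^2) / (1 + x^2 * y^2)).
    { unfold bipolar_re, bipolar_im. field. lra. }
    assert (0 < (1 - x^2) * (1 - y^2) / (1 + x^2 * y^2)); [|lra].
    apply Rdiv_lt_0_compat; [|assumption]. assert (Hx1 := sqr_lt_1 x Hx). assert (Hy1 := sqr_lt_1 y Hy).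
      apply Rmult_lt_0_compat; lra. }
  apply Rnot_le_lt. intros Hge.
  assert (1^2 <= Cmod (bipolar_re x y, bipolar_im x y)^2) by (apply pow_incr; lra). lra.
Qed.

Lemma bipolar_surj (z : C) : Defs.disc z ->
  exists x y, -1 < x < 1 /\ -1 < y < 1 /\ z = (bipolar_re x y, bipolar_im x y).
Proof.
  intros Hz. apply Cmod_lt_1_sqr in Hz. destruct z as [a b]. simpl in Hz.
  set (N := a^2 + b^2). assert (HN : N < 1) by (unfold N; lra).
  (* [P] is [|1 - z^2|]. The formulas for [x] and [y] below are the half-angle formulas for [tanh]
     and [tan], applied where the double angles have [tanh] equal to [2 a / (1 + N)] and [tan] equal
     to [2 b / (1 - N)]. *)
  set (P := sqrt ((1 - N)^2 + 4 * b^2)).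
  assert (Hb := pow2_ge_0 b). assert (Ha := pow2_ge_0 a).
  assert (HQ : 0 < (1 - N)^2 + 4 * b^2).
  { assert (0 < (1 - N)^2) by (apply pow_lt; lra). lra. }
  assert (HP : 0 < P) by (apply sqrt_lt_R0; exact HQ).
  assert (HP2 : P^2 = (1 - N)^2 + 4 * b^2) by (apply pow2_sqrt; lra).
  assert (HP3 : P^2 = (1 + N)^2 - 4 * a^2) by (rewrite HP2; unfold N; ring).
  assert (HN0 : 0 <= N) by (unfold N; lra).
  set (x := 2 * a / (1 + N + P)). set (y := 2 * b / (P + (1 - N))).
  assert (Hx2 : x^2 = (1 + N - P) / (1 + N + P)).
  { unfold x. field_simplify_eq; [|lra].
    replace (4 * a^2) with ((1+N)^2 - P^2) by lra. ring. }
  assert (Hy2 : y^2 = (P - (1 - N)) / (P + (1 - N))).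
  { unfold y. field_simplify_eq; [|lra].
    replace (4 * b^2) with (P^2 - (1-N)^2) by lra. ring. }
  exists x, y. split; [|split].
  - assert (x^2 < 1); [|split; apply Rnot_le_lt; intros Hge; nra].
    rewrite Hx2. apply Rlt_div_l; lra.
  - assert (y^2 < 1); [|split; apply Rnot_le_lt; intros Hge; nra].
    rewrite Hy2. apply Rlt_div_l; lra.
  - unfold bipolar_re, bipolar_im. rewrite Hx2, Hy2. unfold x, y.
    assert (Hd : 0 < (1 + N - P) * (P - (1 - N)) + (1 + N + P) * (P + (1 - N))).
    { replace (_ + _) with (4 * P) by ring. lra. }
    f_equal; field; repeat split; lra.
Qed.

(** * Shearing *)

Lemma differentiable_Re_bipolar (F : C -> C) (x y : R) :
  analytic_on_disc F -> -1 < x < 1 -> -1 < y < 1 ->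
  let d := (C_derive F (bipolar_re x y, bipolar_im x y) * bipolar_factor x y)%C in
  differentiable_pt_lim (fun x y => Re (F (bipolar_re x y, bipolar_im x y))) x y
    ((1 + y^2) * Re d) (- (1 - x^2) * Im d).
Proof.
  intros HF Hx Hy d.
  eapply differentiable_pt_lim_eq;
    [| |apply (differentiable_pt_lim_comp (fun a b => Re (F (a, b))) bipolar_re bipolar_im);
        [apply differentiable_Re, HF, bipolar_disc; assumption
        |apply differentiable_bipolar_re|apply differentiable_bipolar_im]];
  unfold d; destruct (C_derive F _) as [p q], (bipolar_factor x y) as [r s]; simpl; ring.
Qed.

Lemma differentiable_Im_bipolar (F : C -> C) (x y : R) :
  analytic_on_disc F -> -1 < x < 1 -> -1 < y < 1 ->
  let d := (C_derive F (bipolar_re x y, bipolar_im x y) * bipolar_factor x y)%C in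
  differentiable_pt_lim (fun x y => Im (F (bipolar_re x y, bipolar_im x y))) x y
    ((1 + y^2) * Im d) ((1 - x^2) * Re d).
Proof.
  intros HF Hx Hy d.
  eapply differentiable_pt_lim_eq;
    [| |apply (differentiable_pt_lim_comp (fun a b => Im (F (a, b))) bipolar_re bipolar_im);
        [apply differentiable_Im, HF, bipolar_disc; assumption
        |apply differentiable_bipolar_re|apply differentiable_bipolar_im]];
  unfold d; destruct (C_derive F _) as [p q], (bipolar_factor x y) as [r s]; simpl; ring.
Qed.

(** In bipolar coordinates the first condition says that [Re F] increases along rows, the second
    that the Jacobian of [(Re F, Im K)] is positive, and the third that the [y]-derivative of [Re F]
    tends to [0] at the sides [x = 1] and [x = -1]. So [square_level_curve] parametrizes every
    vertical section of the image by [y]. *)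
Lemma shear_convex_imaginary (F K : C -> C) :
  analytic_on_disc F -> analytic_on_disc K ->
  (forall z, Defs.disc z -> 0 < Re ((1 - z^2) * C_derive F z)%C) ->
  (forall z, Defs.disc z -> 0 < Re (C_derive K z * Cconj (C_derive F z))%C) ->
  (forall e, 0 < e -> exists d, 0 < d /\ forall z, Defs.disc z ->
     Cmod (1 - z^2)%C < d -> Cmod ((1 - z^2) * C_derive F z)%C <= e) ->
  convex_in_imaginary_direction (fun z => (Re (F z), Im (K z))).
Proof.
  intros HF HK Hpos HJ Hlim.
  set (DF := fun x y => (C_derive F (bipolar_re x y, bipolar_im x y) * bipolar_factor x y)%C).
  set (DK := fun x y => (C_derive K (bipolar_re x y, bipolar_im x y) * bipolar_factor x y)%C).
  set (U := fun x y => Re (F (bipolar_re x y, bipolar_im x y))).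
  set (V := fun x y => Im (K (bipolar_re x y, bipolar_im x y))).
  set (Ux := fun x y => (1 + y^2) * Re (DF x y)).
  set (Uy := fun x y => - (1 - x^2) * Im (DF x y)).
  set (Vx := fun x y => (1 + y^2) * Im (DK x y)).
  set (Vy := fun x y => (1 - x^2) * Re (DK x y)).
  assert (HU : square_gradient U Ux Uy).
  { intros x y Hx Hy. apply (differentiable_Re_bipolar F); assumption. }
  assert (HV : square_gradient V Vx Vy).
  { intros x y Hx Hy. apply (differentiable_Im_bipolar K); assumption. }
  assert (HDF : forall x y, ((1 - Cpow (bipolar_re x y, bipolar_im x y) 2) *
      C_derive F (bipolar_re x y, bipolar_im x y) = ((1 - x^2) * (1 + y^2))%R * DF x y)%C).
  { intros x y. rewrite bipolar_one_minus_sqr. unfold DF. ring. }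
  assert (HUx : forall x y, -1 < x < 1 -> -1 < y < 1 -> 0 < Ux x y).
  { intros x y Hx Hy. assert (H := Hpos _ (bipolar_disc x y Hx Hy)).
    rewrite HDF, re_scal_l in H. unfold Ux.
    assert (H1 := sqr_lt_1 x Hx). assert (H2 := pow2_ge_0 y).
    rewrite Rmult_assoc in H.
    apply Rmult_lt_reg_l with (1 - x^2); lra. }
  assert (HJac : forall x y, -1 < x < 1 -> -1 < y < 1 ->
     0 < Ux x y * Vy x y - Uy x y * Vx x y).
  { intros x y Hx Hy. assert (H := HJ _ (bipolar_disc x y Hx Hy)).
    assert (E : Ux x y * Vy x y - Uy x y * Vx x y =
      (1 - x^2) * (1 + y^2) * (Re (bipolar_factor x y)^2 + Im (bipolar_factor x y)^2) *
      Re (C_derive K (bipolar_re x y, bipolar_im x y) * Cconj (C_derive F (bipolar_re x y, bipolar_im x y)))%C).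
    { unfold Ux, Uy, Vx, Vy, DF, DK.
      destruct (C_derive F _) as [p q], (C_derive K _) as [p' q'], (bipolar_factor x y) as [r s].
      simpl; ring. }
    rewrite E, bipolar_factor_Cmod.
    assert (H1 := sqr_lt_1 x Hx). assert (H2 := pow2_ge_0 y).
    repeat apply Rmult_lt_0_compat; try lra.
    apply Rinv_0_lt_compat, pow_lt, bipolar_denom_pos. }
  assert (Hedge : forall e, 0 < e -> exists d, 0 < d /\
     forall x y, -1 < x < 1 -> 1 - d < Rabs x -> -1 < y < 1 -> Rabs (Uy x y) <= e).
  { intros e He. destruct (Hlim e He) as (d & Hd & H).
    (* [|x| > 1 - d/4] gives [1 - x^2 < d/2]; then [1 + y^2 < 2] and [|bipolar_factor| <= 1] bring
       [|1 - z^2|] below [d]. *)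
    exists (d / 4). split; [lra|]. intros x y Hx Hxd Hy.
    assert (Hs := bipolar_one_minus_sqr x y). assert (Hx1 := sqr_lt_1 x Hx).
    assert (Hy1 := sqr_lt_1 y Hy). assert (Hy0 := pow2_ge_0 y).
    assert (Hprod : 0 < (1 - x^2) * (1 + y^2)) by (apply Rmult_lt_0_compat; lra).
    assert (Hsp : Cmod (bipolar_factor x y) <= 1).
    { apply Rnot_lt_le. intros Hgt.
      assert (E := Cmod2_alt (bipolar_factor x y)). rewrite bipolar_factor_Cmod in E.
      assert (/ (1 + x^2 * y^2)^2 <= 1).
      { rewrite <- Rinv_1. apply Rinv_le_contravar; [lra|].
        assert (0 <= x^2 * y^2) by (apply Rmult_le_pos; apply pow2_ge_0). nra. }
      nra. }
    assert (Hz : Cmod (1 - Cpow (bipolar_re x y, bipolar_im x y) 2)%C < d).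
    { rewrite Hs, Cmod_mult, Cmod_R, Rabs_pos_eq by lra.
      assert (1 - x^2 < d / 2).
      { assert (Rabs x < 1) by (apply Rabs_def1; lra).
        rewrite <- pow2_abs. assert (Hx0 := Rabs_pos x). nra. }
      assert ((1 - x^2) * (1 + y^2) < d) by nra.
      assert (Hs0 := Cmod_ge_0 (bipolar_factor x y)). nra. }
    specialize (H _ (bipolar_disc x y Hx Hy) Hz). rewrite HDF in H.
    rewrite Cmod_mult, Cmod_R, Rabs_pos_eq in H by lra.
    unfold Uy. rewrite Rabs_mult, Rabs_Ropp, (Rabs_pos_eq (1 - x^2)) by lra.
    assert (Him : Rabs (Im (DF x y)) <= Cmod (DF x y)).
    { eapply Rle_trans; [|apply Rmax_Cmod]. apply Rmax_r. }
    assert (HD0 := Cmod_ge_0 (DF x y)).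
    assert ((1 - x^2) * Rabs (Im (DF x y)) <= (1 - x^2) * Cmod (DF x y)).
    { apply Rmult_le_compat_l; lra. }
    assert (0 <= (1 - x^2) * Cmod (DF x y)) by (apply Rmult_le_pos; lra).
    nra. }
  assert (Hcurve := fun x0 y0 => square_level_curve U Ux Uy V Vx Vy x0 y0 HU HV HUx HJac Hedge).
  assert (Huniq : forall x1 x2 y, -1 < x1 < 1 -> -1 < x2 < 1 -> -1 < y < 1 ->
    U x1 y = U x2 y -> x1 = x2).
  { intros x1 x2 y H1 H2 Hy E. destruct (Rtotal_order x1 x2) as [H|[H|H]]; [|exact H|].
    - assert (U x1 y < U x2 y) by (eapply square_increasing; eauto; lra). lra.
    - assert (U x2 y < U x1 y) by (eapply square_increasing; eauto; lra). lra. }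
  split.
  - intros z w Hz Hw E. injection E as E1 E2.
    destruct (bipolar_surj z Hz) as (x0 & y0 & Hx0 & Hy0 & ->).
    destruct (bipolar_surj w Hw) as (x1 & y1 & Hx1 & Hy1 & ->).
    change (U x0 y0 = U x1 y1) in E1. change (V x0 y0 = V x1 y1) in E2.
    destruct (Hcurve x0 y0 Hx0 Hy0) as [T HT].
    (* Both points lie on one level curve, since [U] agrees at them and a row meets the level
       once. *)
    assert (T0 : T y0 = x0).
    { destruct (HT y0 Hy0) as (H1 & H2 & _). apply Huniq with y0; auto. }
    assert (T1 : T y1 = x1).
    { destruct (HT y1 Hy1) as (H1 & H2 & _). apply Huniq with y1; auto. rewrite H2. exact E1. }
    assert (Hmono : forall a b, -1 < a -> a < b -> b < 1 -> V (T a) a < V (T b) b).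
    { intros a b Ha Hab Hb.
      destruct (MVT_gen (fun v => V (T v) v) a b (Derive (fun v => V (T v) v))) as (c & Hc & Ec).
      - intros c Hc. rewrite Rmin_left, Rmax_right in Hc by lra.
        destruct (HT c) as (_ & _ & l & _ & Hl); [lra|].
        apply Derive_correct. exists l. exact Hl.
      - intros c Hc. rewrite Rmin_left, Rmax_right in Hc by lra.
        destruct (HT c) as (_ & _ & l & _ & Hl); [lra|].
        eapply is_derive_continuity_pt, Hl.
      - rewrite Rmin_left, Rmax_right in Hc by lra.
        destruct (HT c) as (_ & _ & l & Hl0 & Hl); [lra|].
        apply is_derive_unique in Hl. change (V (T b) b - V (T a) a = Derive (fun v => V (T v) v) c * (b - a)) in Ec.
        rewrite (Hl : Derive (fun v : R => V (T v) v) c = l) in Ec.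
        assert (0 < l * (b - a)) by (apply Rmult_lt_0_compat; lra). lra. }
    assert (Ey : y0 = y1).
    { destruct (Rtotal_order y0 y1) as [H|[H|H]]; [|exact H|].
      - assert (H1 := Hmono y0 y1). rewrite T0, T1 in H1. lra.
      - assert (H1 := Hmono y1 y0). rewrite T0, T1 in H1. lra. }
    subst y1. congruence.
  - intros c.
    destruct (excluded_middle_informative
      (exists z, Defs.disc z /\ Re (F z) = c)) as [[z [Hz Ez]]|Hempty].
    + destruct (bipolar_surj z Hz) as (x0 & y0 & Hx0 & Hy0 & ->).
      destruct (Hcurve x0 y0 Hx0 Hy0) as [T HT].
      apply connected_graph with (c := c) (W := fun y => V (T y) y).
      * intros w. split.
        -- intros [[z [Hz' Ew]] Hc].
           destruct (bipolar_surj z Hz') as (x1 & y1 & Hx1 & Hy1 & ->).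
           exists y1. split; [exact Hy1|]. rewrite <- Ew in Hc |- *. simpl in Hc.
           f_equal; [exact Hc|].
           destruct (HT y1 Hy1) as (H1 & H2 & _).
           replace (T y1) with x1; [reflexivity|].
           apply Huniq with y1; auto. rewrite H2. unfold U. congruence.
        -- intros (y & Hy & ->). destruct (HT y Hy) as (H1 & H2 & _). split; [|reflexivity].
           exists (bipolar_re (T y) y, bipolar_im (T y) y). split; [apply bipolar_disc; assumption|].
           f_equal. unfold U in H2. rewrite H2. exact Ez.
      * intros y Hy. destruct (HT y Hy) as (_ & _ & l & _ & Hl).
        apply (is_derive_continuity_pt _ _ _ Hl).
    + intros A1 A2 _ _ _ _ [w [[[z [Hz Ew]] Hc] _]] _.
      apply Hempty. exists z. split; [exact Hz|]. rewrite <- Hc, <- Ew. reflexivity.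
Qed.

(** * Hadamard product with the logarithm *)

Lemma is_series_Re (u : nat -> C) (l : C) :
  is_series (K := C_AbsRing) (V := C_NormedModule) u l -> is_series (fun k => Re (u k)) (Re l).
Proof.
  intros H. unfold is_series in *.
  apply filterlim_ext with (fun n => Re (sum_n u n)).
  - intros n. induction n as [|n IH].
    + rewrite !sum_O. reflexivity.
    + rewrite !sum_Sn, <- IH. reflexivity.
  - eapply filterlim_comp. exact H.
    intros P [e He]. exists e. intros y Hy. apply He. apply Hy.
Qed.

Lemma is_series_Im (u : nat -> C) (l : C) :
  is_series (K := C_AbsRing) (V := C_NormedModule) u l -> is_series (fun k => Im (u k)) (Im l).
Proof.
  intros H. unfold is_series in *.
  apply filterlim_ext with (fun n => Im (sum_n u n)).
  - intros n. induction n as [|n IH].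
    + rewrite !sum_O. reflexivity.
    + rewrite !sum_Sn, <- IH. reflexivity.
  - eapply filterlim_comp. exact H.
    intros P [e He]. exists e. intros y Hy. apply He. apply Hy.
Qed.

Lemma C_pow_n (z : C) (k : nat) : pow_n (K := C_AbsRing) z k = (z ^ k)%C.
Proof. induction k as [|k IH]; [reflexivity|]. simpl. rewrite IH. reflexivity. Qed.

Lemma is_pseries_C_series (a : nat -> C) (z l : C) :
  is_pseries (K := C_AbsRing) (V := C_NormedModule) a z l ->
  is_series (K := C_AbsRing) (V := C_NormedModule) (fun k => (z ^ k * a k)%C) l.
Proof.
  intros H. eapply is_series_ext; [|exact H]. intros k. rewrite C_pow_n. reflexivity.
Qed.

(** Along a fixed ray the real and imaginary parts of a complex power series are real power series
    in [r], which opens it to the real theory of radii and derivatives. *)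
Lemma is_pseries_Re_ray (a : nat -> C) (z l : C) (r : R) :
  is_pseries (K := C_AbsRing) (V := C_NormedModule) a (r * z)%C l ->
  is_pseries (fun k => Re (z ^ k * a k)%C) r (Re l).
Proof.
  intros H. apply is_pseries_C_series, is_series_Re in H.
  eapply is_series_ext; [|exact H]. intros k. cbv beta.
  rewrite pow_n_pow, Cpow_mult_l, <- RtoC_pow, <- Cmult_assoc, re_scal_l. reflexivity.
Qed.

Lemma is_pseries_Im_ray (a : nat -> C) (z l : C) (r : R) :
  is_pseries (K := C_AbsRing) (V := C_NormedModule) a (r * z)%C l ->
  is_pseries (fun k => Im (z ^ k * a k)%C) r (Im l).
Proof.
  intros H. apply is_pseries_C_series, is_series_Im in H.
  eapply is_series_ext; [|exact H]. intros k. cbv beta.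
  rewrite pow_n_pow, Cpow_mult_l, <- RtoC_pow, <- Cmult_assoc, im_scal_l. reflexivity.
Qed.

(** Beyond the radius of convergence the terms would not tend to [0]. *)
Lemma CV_radius_ge (c : nat -> R) (x l : R) : is_pseries c x l -> Rbar_le (Rabs x) (CV_radius c).
Proof.
  intros H. apply Rbar_not_lt_le. intros Hlt. apply CV_disk_outside in Hlt. apply Hlt.
  apply ex_series_lim_0. exists l. eapply is_series_ext; [|exact H].
  intros k. rewrite pow_n_pow. apply Rmult_comm.
Qed.

Lemma CV_radius_gt (c : nat -> R) (u : R -> R) (rho x : R) :
  (forall r, Rabs r < rho -> is_pseries c r (u r)) -> Rabs x < rho ->
  Rbar_lt (Rabs x) (CV_radius c).
Proof.
  intros H Hx. assert (H0 := Rabs_pos x).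
  assert (Hm : Rabs ((Rabs x + rho) / 2) < rho) by (rewrite (Rabs_pos_eq ((Rabs x + rho) / 2)); lra).
  apply Rbar_lt_le_trans with (2 := CV_radius_ge _ _ _ (H _ Hm)).
  simpl. rewrite (Rabs_pos_eq ((Rabs x + rho) / 2)); lra.
Qed.

Lemma is_derive_pseries_sum (c : nat -> R) (u : R -> R) (rho x : R) :
  (forall r, Rabs r < rho -> is_pseries c r (u r)) -> Rabs x < rho ->
  exists l, is_derive u x l /\ is_pseries (PS_derive c) x l.
Proof.
  intros H Hx. assert (Hr := CV_radius_gt c u rho x H Hx).
  exists (Derive (PSeries c) x). split; [|apply is_pseries_derive, Hr].
  apply is_derive_ext_loc with (PSeries c).
  - apply (locally_interval _ x (-rho) rho); simpl.
    + apply Rabs_def2 in Hx. lra.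
    + apply Rabs_def2 in Hx. lra.
    + intros y H1 H2. apply is_pseries_unique, H, Rabs_def1; assumption.
  - apply Derive_correct, ex_derive_PSeries, Hr.
Qed.

(** Both coefficients, times [n!], are the [n]-th derivative of the common sum at [0]. *)
Lemma pseries_coef_unique (c c' : nat -> R) (u : R -> R) (rho : R) (n : nat) : 0 < rho ->
  (forall r, Rabs r < rho -> is_pseries c r (u r)) ->
  (forall r, Rabs r < rho -> is_pseries c' r (u r)) -> c n = c' n.
Proof.
  intros Hrho H H'.
  assert (H0 : Rabs 0 < rho) by (rewrite Rabs_R0; exact Hrho).
  assert (R1 := CV_radius_gt c u rho 0 H H0). assert (R2 := CV_radius_gt c' u rho 0 H' H0).
  rewrite Rabs_R0 in R1, R2.
  apply Rmult_eq_reg_r with (INR (Factorial.fact n)); [|apply INR_fact_neq_0].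
  rewrite <- (Derive_n_coef c), <- (Derive_n_coef c') by assumption.
  apply Derive_n_ext_loc.
  apply (locally_interval _ 0 (-rho) rho); simpl; try lra.
  intros y H1 H2. rewrite (is_pseries_unique c y (u y)), (is_pseries_unique c' y (u y)); auto.
  apply H', Rabs_def1; lra. apply H, Rabs_def1; lra.
Qed.

Lemma is_pseries_geom (x : R) : Rabs x < 1 -> is_pseries (fun _ => 1) x (/ (1 - x)).
Proof.
  intros Hx. eapply is_series_ext; [|apply is_series_geom, Hx].
  intros k. rewrite pow_n_pow. symmetry. apply Rmult_1_r.
Qed.

Lemma Clog_real (x : R) : Rabs x < 1 -> Clog (1 / (1 - x))%C = RtoC (- ln (1 - x)).
Proof.
  intros Hx. apply Rabs_def2 in Hx.
  assert (E : (1 / (1 - x))%C = RtoC (/ (1 - x))).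
  { rewrite RtoC_inv, RtoC_minus by lra. unfold Cdiv. ring. }
  assert (Hp : 0 < / (1 - x)) by (apply Rinv_0_lt_compat; lra).
  rewrite E. unfold Clog, Carg. rewrite Cmod_R, Rabs_pos_eq by lra.
  rewrite re_RtoC, im_RtoC, Rdiv_diag, acos_1 by lra.
  destruct (Rle_dec 0 0) as [_|]; [|lra].
  rewrite ln_Rinv by lra. reflexivity.
Qed.

(** On the real segment the logarithm is real, so the imaginary parts of the coefficients vanish;
    the real parts are found by differentiating, which turns the series into the geometric one. *)
Lemma log_expansion_coef (b : nat -> C) (k : nat) :
  disc_expansion b (fun z => Clog (1 / (1 - z))%C) -> b (S k) = RtoC (/ INR (S k)).
Proof.
  intros [_ H].
  assert (Hreal : forall x, Rabs x < 1 ->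
    is_pseries (K := C_AbsRing) (V := C_NormedModule) b (x * 1)%C (RtoC (- ln (1 - x)))).
  { intros x Hx. rewrite <- (Clog_real x Hx), Cmult_1_r. apply H.
    unfold Defs.disc. rewrite Cmod_R. exact Hx. }
  assert (Hre : forall x, Rabs x < 1 -> is_pseries (fun k => Re (b k)) x (- ln (1 - x))).
  { intros x Hx. assert (Hs := is_pseries_Re_ray _ _ _ _ (Hreal x Hx)).
    eapply is_pseries_ext; [|exact Hs]. intros j. cbv beta.
    rewrite Cpow_1_l, Cmult_1_l. reflexivity. }
  assert (Him : forall x, Rabs x < 1 -> is_pseries (fun k => Im (b k)) x 0).
  { intros x Hx. assert (Hs := is_pseries_Im_ray _ _ _ _ (Hreal x Hx)).
    eapply is_pseries_ext; [|exact Hs]. intros j. cbv beta.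
    rewrite Cpow_1_l, Cmult_1_l. reflexivity. }
  assert (Hder : forall x, Rabs x < 1 -> is_pseries (PS_derive (fun k => Re (b k))) x (/ (1 - x))).
  { intros x Hx. destruct (is_derive_pseries_sum _ _ 1 x Hre Hx) as (l & Hl & Hps).
    replace (/ (1 - x)) with l; [exact Hps|].
    apply is_derive_unique in Hl. rewrite <- Hl. apply is_derive_unique.
    apply Rabs_def2 in Hx. auto_derive. lra. field. lra. }
  assert (E1 : PS_derive (fun k => Re (b k)) k = 1).
  { apply (pseries_coef_unique _ (fun _ => 1) (fun x => / (1 - x)) 1 k); auto. lra.
    apply is_pseries_geom. }
  assert (E2 : Im (b (S k)) = 0).
  { apply (pseries_coef_unique (fun k => Im (b k)) (fun _ => 0) (fun _ => 0) 1 (S k)); auto. lra.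
    intros r Hr.
    (* The zero series is obtained as [0] times the geometric series. *)
    assert (Hs : is_pseries (PS_scal 0 (fun _ : nat => 1)) r (0 * / (1 - r))).
    { exact (is_pseries_scal 0 (fun _ : nat => 1) r (/ (1 - r)) (Rmult_comm r 0) (is_pseries_geom r Hr)). }
    rewrite Rmult_0_l in Hs.
    eapply is_pseries_ext; [|exact Hs]. intros j. apply Rmult_0_l. }
  unfold PS_derive in E1.
  assert (Hk : INR (S k) <> 0) by (apply not_0_INR; discriminate).
  apply injective_projections.
  - change (Re (b (S k)) = / INR (S k)). apply Rmult_eq_reg_l with (INR (S k)); [|exact Hk].
    rewrite E1. field. exact Hk.
  - exact E2.
Qed.

(* [P] is already known to be holomorphic, so it is enough to differentiate along
   the ray through [z], where real power series suffice. *)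
Lemma radial_derivative_sum (c e : nat -> R) (u : R -> R) (rho l m : R) : 1 < rho ->
  (forall r, Rabs r < rho -> is_pseries c r (u r)) -> is_series e m ->
  e 0%nat = 0 -> (forall k, INR (S k) * c (S k) = e (S k)) -> is_derive u 1 l -> l = m.
Proof.
  intros Hrho Hc He He0 Hce Hu.
  assert (H1 : Rabs 1 < rho) by (rewrite Rabs_R1; exact Hrho).
  destruct (is_derive_pseries_sum c u rho 1 Hc H1) as (l' & Hl' & Hps).
  apply is_derive_unique in Hl'. apply is_derive_unique in Hu. rewrite <- Hu, Hl'.
  assert (Hs : is_series (fun k => e (S k)) l').
  { eapply is_series_ext; [|exact Hps]. intros k. cbv beta.
    rewrite pow_n_pow, pow1. unfold PS_derive. rewrite Hce. apply Rmult_1_l. }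
  rewrite <- (is_series_unique _ _ He), <- (is_series_unique _ _ Hs).
  rewrite (Series_incr_1 e), He0 by (exists m; exact He). ring.
Qed.

Lemma is_derive_along_ray (f : C -> C) (z : C) :
  ex_derive (K := C_AbsRing) (V := C_NormedModule) f z ->
  is_derive (fun r : R => Re (f (r * z)%C)) 1 (Re (z * C_derive f z)%C) /\
  is_derive (fun r : R => Im (f (r * z)%C)) 1 (Im (z * C_derive f z)%C).
Proof.
  destruct z as [x y]. intros Hf.
  assert (E : forall r : R, (r * (x, y))%C = (r * x, r * y)).
  { intros r. apply injective_projections; simpl; ring. }
  assert (Hx : forall w, derivable_pt_lim (fun r => r * w) 1 w).
  { intros w. apply is_derive_Reals. auto_derive; [exact I|ring]. }
  assert (Hf' : ex_derive (K := C_AbsRing) (V := C_NormedModule) f (1 * x, 1 * y)).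
  { rewrite !Rmult_1_l. exact Hf. }
  split; apply is_derive_Reals.
  - eapply derivable_pt_lim_ext; [intros r; rewrite E; reflexivity|].
    replace (Re _) with (Re (C_derive f (1 * x, 1 * y)) * x + - Im (C_derive f (1 * x, 1 * y)) * y).
    + apply (derivable_pt_lim_comp_2d (fun a b => Re (f (a, b)))); auto.
      apply differentiable_Re, Hf'.
    + rewrite !Rmult_1_l. simpl. unfold Re, Im. ring.
  - eapply derivable_pt_lim_ext; [intros r; rewrite E; reflexivity|].
    replace (Im _) with (Im (C_derive f (1 * x, 1 * y)) * x + Re (C_derive f (1 * x, 1 * y)) * y).
    + apply (derivable_pt_lim_comp_2d (fun a b => Im (f (a, b)))); auto.
      apply differentiable_Im, Hf'.
    + rewrite !Rmult_1_l. simpl. unfold Re, Im. ring.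
Qed.

(** The operator [z d/dz] multiplies the [k]-th coefficient by [k], which cancels the factor [1/k]
    coming from the logarithm. *)
Lemma hadamard_log_derive (F P : C -> C) (z : C) :
  is_hadamard_product F (fun z => Clog (1 / (1 - z))%C) P -> analytic_on_disc P ->
  Defs.disc z -> z <> 0 -> (z * C_derive P z)%C = F z.
Proof.
  intros (a & b & [Ha0 Ha] & Hb & [Hab0 Hab]) HP Hz Hz0.
  assert (Hm : 0 < Cmod z) by (apply Cmod_gt_0; exact Hz0).
  (* The ray [r * z] stays in the disc for [|r| < 1/|z|], so [r = 1] is an interior parameter. *)
  assert (Hrho : 1 < / Cmod z).
  { rewrite <- Rinv_1. apply Rinv_lt_contravar; [lra|exact Hz]. }
  assert (Hps : forall r : R, Rabs r < / Cmod z ->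
    is_pseries (K := C_AbsRing) (V := C_NormedModule) (fun k => a k * b k)%C (r * z)%C (P (r * z)%C)).
  { intros r Hr. apply Hab. unfold Defs.disc. rewrite Cmod_mult, Cmod_R.
    replace 1 with (/ Cmod z * Cmod z) by (field; lra).
    apply Rmult_lt_compat_r; assumption. }
  assert (HF := is_pseries_C_series _ _ _ (Ha z Hz)).
  assert (Hcoef : forall k, (INR (S k) * (z ^ S k * (a (S k) * b (S k))) = z ^ S k * a (S k))%C).
  { intros k. rewrite (log_expansion_coef b k Hb), RtoC_inv by (apply not_0_INR; discriminate).
    field. intros E. apply RtoC_inj in E. revert E. apply not_0_INR. discriminate. }
  destruct (is_derive_along_ray P z (HP z Hz)) as [HRe HIm].
  apply injective_projections.
- eapply (radial_derivative_sum (fun k => Re (z ^ k * (a k * b k))%C) (fun k => Re (z ^ k * a k)%C)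
      (fun r => Re (P (r * z)%C)) (/ Cmod z)).
    * exact Hrho.
    * intros r Hr. apply is_pseries_Re_ray with (a := fun k => (a k * b k)%C), Hps, Hr.
    * exact (is_series_Re _ _ HF).
    * rewrite Ha0, Cmult_0_r. reflexivity.
    * intros k. rewrite <- Hcoef, re_scal_l. reflexivity.
    * exact HRe.
- eapply (radial_derivative_sum (fun k => Im (z ^ k * (a k * b k))%C) (fun k => Im (z ^ k * a k)%C)
      (fun r => Im (P (r * z)%C)) (/ Cmod z)).
    * exact Hrho.
    * intros r Hr. apply is_pseries_Im_ray with (a := fun k => (a k * b k)%C), Hps, Hr.
    * exact (is_series_Im _ _ HF).
    * rewrite Ha0, Cmult_0_r. reflexivity.
    * intros k. rewrite <- Hcoef, im_scal_l. reflexivity.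
    * exact HIm.
Qed.

(** * The derivative of the sheared function *)

Lemma is_derive_Cscal (f : C -> C) (c z l : C) :
  is_derive (K := C_AbsRing) (V := C_NormedModule) f z l ->
  is_derive (K := C_AbsRing) (V := C_NormedModule) (fun w => (c * f w)%C) z (c * l)%C.
Proof.
  intros H. eapply filterdiff_ext_lin.
  - apply (filterdiff_scal_r_fct (K := C_AbsRing) (U := AbsRing_NormedModule C_AbsRing) (V := C_NormedModule) c f).
    + exact Cmult_comm.
    + exact H.
  - intros w. change (c * (w * l) = w * (c * l))%C. ring.
Qed.

Lemma is_derive_Ccomb (f g : C -> C) (c d z : C) :
  ex_derive (K := C_AbsRing) (V := C_NormedModule) f z ->
  ex_derive (K := C_AbsRing) (V := C_NormedModule) g z ->
  is_derive (K := C_AbsRing) (V := C_NormedModule) (fun w => (c * f w + d * g w)%C) z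
    (c * C_derive f z + d * C_derive g z)%C.
Proof.
  intros Hf Hg.
  apply (is_derive_plus (K := C_AbsRing) (V := C_NormedModule)
    (fun w => (c * f w)%C) (fun w => (d * g w)%C));
  apply is_derive_Cscal, C_derive_correct; try assumption; exact 0.
Qed.

Lemma analytic_Ccomb (f g : C -> C) (c d : C) :
  analytic_on_disc f -> analytic_on_disc g -> analytic_on_disc (fun w => (c * f w + d * g w)%C).
Proof. intros Hf Hg z Hz. eexists. apply is_derive_Ccomb; auto. Qed.

Lemma C_derive_Ccomb (f g : C -> C) (c d z : C) :
  analytic_on_disc f -> analytic_on_disc g -> Defs.disc z ->
  C_derive (fun w => (c * f w + d * g w)%C) z = (c * C_derive f z + d * C_derive g z)%C.
Proof. intros Hf Hg Hz. apply is_C_derive_unique, is_derive_Ccomb; auto. Qed.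

(** The lowest factor turns [1 - w] into [1 - w^2], with [w = z^(2^s)]; the induction therefore
    needs every starting exponent [s]. *)
Lemma Cprod_list_telescope (z : C) (s m : nat) :
  (Cprod_list (map (fun k => 1 + z ^ (2 ^ k)) (seq s m)) * (1 - z ^ (2 ^ s)) = 1 - z ^ (2 ^ (s + m)))%C.
Proof.
  revert s. induction m as [|m IH]; intros s.
  - simpl. rewrite Nat.add_0_r. ring.
  - rewrite <- Nat.add_succ_comm, <- IH.
    change (Cprod_list (map (fun k => 1 + z ^ 2 ^ k) (seq s (S m))))%C
      with ((1 + z ^ 2 ^ s) * Cprod_list (map (fun k => 1 + z ^ 2 ^ k) (seq (S s) m)))%C.
    replace (z ^ 2 ^ S s)%C with (z ^ 2 ^ s * z ^ 2 ^ s)%C; [ring|].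
    rewrite <- Cpow_add_r. f_equal. simpl. lia.
Qed.

(** The closed form of [(1 - z^2) (h + g)']. *)
Definition half_plane_kernel (n : nat) (alpha : R) (z : C) : C :=
  let v := (z ^ (2 ^ (n - 1)))%C in ((1 - v^2) * (1 + v^2 + alpha * v) / (1 + v^4))%C.

Lemma kernel_to_half_plane (n : nat) (alpha : R) (z : C) :
  (2 <= n)%nat -> Defs.disc z -> ((1 - z^2) * kernel n alpha z = z * half_plane_kernel n alpha z)%C.
Proof.
  intros Hn Hz. unfold kernel, half_plane_kernel.
  assert (Hp := Cprod_list_telescope z 1 (n - 1)).
  replace (1 + (n - 1))%nat with n in Hp by lia.
  change (2 ^ 1)%nat with 2%nat in Hp.
  assert (E1 : (z ^ 2 ^ n)%C = ((z ^ 2 ^ (n - 1)) ^ 2)%C).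
  { rewrite <- Cpow_mult_r. f_equal. replace n with (S (n - 1)) at 1 by lia.
    rewrite Nat.pow_succ_r'. lia. }
  assert (E2 : (z ^ 2 ^ (n + 1))%C = ((z ^ 2 ^ (n - 1)) ^ 4)%C).
  { rewrite <- Cpow_mult_r. f_equal. replace (n + 1)%nat with (S (S (n - 1))) by lia.
    rewrite !Nat.pow_succ_r'. lia. }
  rewrite E1 in Hp |- *. rewrite E2. rewrite <- Hp.
  set (v := (z ^ 2 ^ (n - 1))%C) in *.
  assert (Hv : (1 + v ^ 4)%C <> 0).
  { apply Cplus_1_neq_0, Cmod_pow_lt_1; [lia|]. apply Cmod_pow_lt_1; [|exact Hz].
    assert (H := Nat.pow_nonzero 2 (n - 1)). lia. }
  field. exact Hv.
Qed.

Lemma half_plane_kernel_comb (n : nat) (a1 a2 t : R) (z : C) :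
  (t * half_plane_kernel n a1 z + (1 - t)%R * half_plane_kernel n a2 z =
   half_plane_kernel n (t * a1 + (1 - t) * a2) z)%C.
Proof.
  unfold half_plane_kernel, Cdiv. rewrite RtoC_plus, !RtoC_mult, RtoC_minus. ring.
Qed.

Lemma hadamard_derivative (n : nat) (alpha : R) (P : C -> C) (z : C) :
  (2 <= n)%nat -> analytic_on_disc P -> C_derive P 0 = 1 ->
  is_hadamard_product (kernel n alpha) (fun z => Clog (1 / (1 - z))%C) P ->
  Defs.disc z -> ((1 - z^2) * C_derive P z = half_plane_kernel n alpha z)%C.
Proof.
  (* The identity for [z P'] says nothing about [P'] at [0]; there the normalization supplies the
     value. *)
  intros Hn HP HP0 Hh Hz. destruct (Ceq_dec z 0) as [->|Hz0].
  - rewrite HP0. unfold half_plane_kernel.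
    replace (0 ^ 2 ^ (n - 1))%C with (RtoC 0).
    + simpl. unfold Cdiv. replace (1 + 0 * (0 * (0 * (0 * 1))))%C with (RtoC 1) by ring.
      field_simplify. reflexivity.
    + assert (H := Nat.pow_nonzero 2 (n - 1)). destruct (2 ^ (n - 1))%nat; [lia|]. simpl. ring.
  - assert (H := hadamard_log_derive _ _ z Hh HP Hz Hz0).
    assert (Hk := kernel_to_half_plane n alpha z Hn Hz). rewrite <- H in Hk.
    assert (E : (z * ((1 - z^2) * C_derive P z) = z * half_plane_kernel n alpha z)%C).
    { rewrite <- Hk. ring. }
    replace (half_plane_kernel n alpha z) with (/ z * (z * half_plane_kernel n alpha z))%C by (field; exact Hz0).
    rewrite <- E. field. exact Hz0.
Qed.

(** The harmonic decomposition is [h = (F + K)/2], [g = (F - K)/2]. By the Cauchy-Riemann relations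
    the Jacobian is [Re (K' conj F')], and at [0] the partial derivatives are [1] and [i]. *)
Lemma S_H_of_shear (F K : C -> C) :
  analytic_on_disc F -> analytic_on_disc K -> F 0 = 0 -> K 0 = 0 ->
  C_derive F 0 = 1 -> C_derive K 0 = 1 ->
  (forall z, Defs.disc z -> 0 < Re (C_derive K z * Cconj (C_derive F z))%C) ->
  univalent_on_disc (fun z => (Re (F z), Im (K z))) ->
  S_H (fun z => (Re (F z), Im (K z))).
Proof.
  intros HF HK F0 K0 F0' K0' HJ Hu.
  assert (Hx : forall z, Defs.disc z ->
    partial_x (fun z => (Re (F z), Im (K z))) z = (Re (C_derive F z), Im (C_derive K z))).
  { intros [x y] Hz. unfold partial_x. simpl.
    destruct (differentiable_pt_lim_unique _ _ _ _ _ (differentiable_Re F x y (HF _ Hz))) as [-> _].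
    destruct (differentiable_pt_lim_unique _ _ _ _ _ (differentiable_Im K x y (HK _ Hz))) as [-> _].
    reflexivity. }
  assert (Hy : forall z, Defs.disc z ->
    partial_y (fun z => (Re (F z), Im (K z))) z = (- Im (C_derive F z), Re (C_derive K z))).
  { intros [x y] Hz. unfold partial_y. simpl.
    destruct (differentiable_pt_lim_unique _ _ _ _ _ (differentiable_Re F x y (HF _ Hz))) as [_ ->].
    destruct (differentiable_pt_lim_unique _ _ _ _ _ (differentiable_Im K x y (HK _ Hz))) as [_ ->].
    reflexivity. }
  assert (H0 : Defs.disc 0) by (unfold Defs.disc; rewrite Cmod_0; lra).
  split; [|split; [|split; [exact Hu|split]]].
  - exists (fun z => ((/ 2)%R * F z + (/ 2)%R * K z)%C), (fun z => ((/ 2)%R * F z + (- / 2)%R * K z)%C).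
    split; [|split]; [apply analytic_Ccomb; assumption..|].
    intros z _. unfold harmonic_map. destruct (F z), (K z).
    apply injective_projections; simpl; field.
  - intros z Hz. unfold jacobian. rewrite (Hx z Hz), (Hy z Hz).
    specialize (HJ z Hz). destruct (C_derive F z), (C_derive K z). simpl in *. lra.
  - rewrite F0, K0. reflexivity.
  - unfold wirtinger. rewrite (Hx 0 H0), (Hy 0 H0), F0', K0'.
    apply injective_projections; simpl; field.
Qed.

(** * The Jacobian of the convex combination *)

Lemma sqrt2_bound : 2 * (sqrt 2 - 1) <= 829/1000.
Proof.
  assert (H : sqrt 2 * sqrt 2 = 2) by (apply sqrt_sqrt; lra).
  assert (H1 := sqrt_pos 2). apply Rnot_lt_le. intros Hlt. nra.
Qed.

(** Here [a] and [b] stand for [h1'] and [h2'], and [s] for the factor common to [F1'] and [F2'].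
    Multiplying by [|1 - u|^2 |1 + u^2|^2] clears the denominators and leaves [|s|^2] times the
    expression of [cross_term_nonneg]. *)
Lemma jacobian_cross_term (u a b s : C) (a1 a2 : R) :
  Cmod u < 1 -> -(829/1000) <= a1 -> a1 <= a2 -> a2 <= 829/1000 ->
  ((1 - u) * a = s * (1 + u^4 + a1 * u^2))%C ->
  ((1 + u^2) * b = s * (1 + u^4 + a2 * u^2))%C ->
  0 <= Re (a * Cconj b * (1 + (Cmod u ^ 2)%R * Cconj u))%C.
Proof.
  intros Hu H1 H12 H2 Ea Eb.
  assert (Hpos := cross_term_nonneg u a1 a2 Hu H1 H12 H2).
  assert (Hu1 := Cminus_1_neq_0 u Hu).
  assert (Hu2 : (1 + u^2)%C <> 0) by (apply Cplus_1_neq_0, Cmod_pow_lt_1; [lia|exact Hu]).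
  set (m := Cmod (1 - u)%C ^ 2 * Cmod (1 + u^2)%C ^ 2).
  assert (Hm : 0 < m).
  { apply Cmod_gt_0 in Hu1. apply Cmod_gt_0 in Hu2.
    apply Rmult_lt_0_compat; apply pow_lt; assumption. }
  set (X := (1 + (Cmod u ^ 2)%R * Cconj u)%C) in *.
  assert (E : (m * (a * Cconj b * X) = (Cmod s ^ 2)%R *
    ((1 + u ^ 4 + a1 * u ^ 2) * Cconj (1 + u ^ 4 + a2 * u ^ 2) * ((1 - Cconj u) * (1 + u ^ 2) * X)))%C).
  { unfold m. rewrite RtoC_mult, !Cmod2_conj.
    transitivity (((1 - u) * a) * Cconj ((1 + u^2) * b) * (Cconj (1 - u) * (1 + u^2) * X))%C.
    - rewrite Cmult_conj. ring.
    - rewrite Ea, Eb, Cmult_conj.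
      replace (Cconj (1 - u)) with (1 - Cconj u)%C by (apply injective_projections; simpl; ring).
      ring. }
  apply (f_equal Re) in E. rewrite !re_scal_l in E.
  apply Rmult_le_reg_l with m; [exact Hm|]. rewrite Rmult_0_r, E.
  apply Rmult_le_pos; [apply pow2_ge_0|exact Hpos].
Qed.

(** The square terms carry the Jacobians [|h'|^2 (1 - |w|^2)] of the two mappings, [w] being the
    dilatation. In the mixed terms [(1 + u)(1 + conj u^2)] and [(1 - u)(1 - conj u^2)] add up to
    [2 (1 + |u|^2 conj u)]. *)
Lemma jacobian_comb (u a b : C) (t : R) :
  Re ((t * ((1 + u) * a) + (1 - t)%R * ((1 - u^2) * b)) *
      Cconj (t * ((1 - u) * a) + (1 - t)%R * ((1 + u^2) * b)))%C =
  t^2 * Cmod a ^ 2 * (1 - Cmod u ^ 2) + (1 - t)^2 * Cmod b ^ 2 * (1 - (Cmod u ^ 2)^2)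
  + 2 * t * (1 - t) * Re (a * Cconj b * (1 + (Cmod u ^ 2)%R * Cconj u))%C.
Proof.
  rewrite !Cmod2_alt. destruct u, a, b. simpl. ring.
Qed.

(** * Sums and differences of analytic functions, and kernel bounds on the disc *)

Lemma analytic_plus (f g : C -> C) :
  analytic_on_disc f -> analytic_on_disc g -> analytic_on_disc (fun w => f w + g w)%C.
Proof.
  intros Hf Hg z Hz. apply (ex_derive_plus (K := C_AbsRing) (V := C_NormedModule) f g); auto.
Qed.

Lemma analytic_minus (f g : C -> C) :
  analytic_on_disc f -> analytic_on_disc g -> analytic_on_disc (fun w => f w - g w)%C.
Proof.
  intros Hf Hg z Hz. apply (ex_derive_minus (K := C_AbsRing) (V := C_NormedModule) f g); auto.
Qed.

Lemma C_derive_plus (f g : C -> C) (z : C) :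
  analytic_on_disc f -> analytic_on_disc g -> Defs.disc z ->
  C_derive (fun w => f w + g w)%C z = (C_derive f z + C_derive g z)%C.
Proof.
  intros Hf Hg Hz. apply is_C_derive_unique.
  apply (is_derive_plus (K := C_AbsRing) (V := C_NormedModule) f g);
    apply C_derive_correct; auto; exact 0.
Qed.

Lemma C_derive_minus (f g : C -> C) (z : C) :
  analytic_on_disc f -> analytic_on_disc g -> Defs.disc z ->
  C_derive (fun w => f w - g w)%C z = (C_derive f z - C_derive g z)%C.
Proof.
  intros Hf Hg Hz. apply is_C_derive_unique.
  apply (is_derive_minus (K := C_AbsRing) (V := C_NormedModule) f g);
    apply C_derive_correct; auto; exact 0.
Qed.

Lemma pow_2_pos (n : nat) : (0 < 2 ^ n)%nat.
Proof. assert (H := Nat.pow_nonzero 2 n). lia. Qed.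

Lemma half_plane_kernel_pos (n : nat) (a : R) (z : C) :
  -(829/1000) <= a <= 829/1000 -> Defs.disc z -> 0 < Re (half_plane_kernel n a z).
Proof.
  intros Ha Hz. apply half_plane_pos; [|exact Ha].
  apply Cmod_pow_lt_1; [apply pow_2_pos|exact Hz].
Qed.

Lemma half_plane_kernel_limit (n : nat) (a e : R) : (2 <= n)%nat ->
  -(829/1000) <= a <= 829/1000 -> 0 < e ->
  exists d, 0 < d /\ forall z, Defs.disc z -> Cmod (1 - z^2)%C < d -> Cmod (half_plane_kernel n a z) <= e.
Proof.
  intros Hn Ha He.
  set (M := INR (2 ^ (n - 1))).
  assert (HM : 0 < M) by (apply lt_0_INR, pow_2_pos).
  (* [M] is the loss in passing from [z^2] to [v^2]. The first bound makes [half_plane_bound]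
     applicable, the second compensates its factor [3]. *)
  exists (Rmin (1 / 2 / M) (e / 3 / M)). split.
  { apply Rmin_glb_lt; repeat apply Rdiv_lt_0_compat; lra. }
  intros z Hz Hd.
  assert (Hd1 : Cmod (1 - z^2)%C * M < 1 / 2).
  { apply Rlt_div_r; [exact HM|]. eapply Rlt_le_trans. exact Hd. apply Rmin_l. }
  assert (Hd2 : Cmod (1 - z^2)%C * M < e / 3).
  { apply Rlt_div_r; [exact HM|]. eapply Rlt_le_trans. exact Hd. apply Rmin_r. }
  assert (Hv : Cmod (1 - (z ^ 2 ^ (n - 1)) ^ 2)%C <= M * Cmod (1 - z^2)%C).
  { replace ((z ^ 2 ^ (n - 1)) ^ 2)%C with ((z ^ 2) ^ 2 ^ (n - 1))%C.
    - apply Cmod_1_minus_pow. left. apply Cmod_pow_lt_1; [lia|exact Hz].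
    - rewrite <- !Cpow_mult_r. f_equal. lia. }
  eapply Rle_trans; [apply half_plane_bound|].
  - apply Cmod_pow_lt_1; [apply pow_2_pos|exact Hz].
  - exact Ha.
  - lra.
  - lra.
Qed.

(** * Univalence and convexity of the convex combination *)

Open Scope C_scope.

Theorem theorem3p11 (n : nat) (alpha1 alpha2 t : R) (h1 g1 h2 g2 : C -> C) :
  (2 <= n)%nat ->
  (- (2 * (sqrt 2 - 1)) <= alpha1 <= 2 * (sqrt 2 - 1))%R ->
  (- (2 * (sqrt 2 - 1)) <= alpha2 <= 2 * (sqrt 2 - 1))%R ->
  (0 <= t <= 1)%R ->
  normalized_harmonic h1 g1 ->
  normalized_harmonic h2 g2 ->
  is_hadamard_product (kernel n alpha1) (fun z => Clog (1 / (1 - z)))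
    (fun z => h1 z + g1 z) ->
  is_hadamard_product (kernel n alpha2) (fun z => Clog (1 / (1 - z)))
    (fun z => h2 z + g2 z) ->
  is_dilatation h1 g1 (fun z => - z ^ (2 ^ (n - 2))) ->
  is_dilatation h2 g2 (fun z => z ^ (2 ^ (n - 1))) ->
  (alpha1 <= alpha2)%R ->
  let f := fun z : C =>
    t * harmonic_map h1 g1 z + (1 - t)%R * harmonic_map h2 g2 z in
  S_H f /\ convex_in_imaginary_direction f.
Proof.
  intros Hn Ha1 Ha2 Ht (Hh1 & Hg1 & Zh1 & Zg1 & Nh1) (Hh2 & Hg2 & Zh2 & Zg2 & Nh2)
    Had1 Had2 Hd1 Hd2 Ha f.
  assert (Hsq := sqrt2_bound).
  assert (Hb1 : (-(829/1000) <= alpha1 <= 829/1000)%R) by lra.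
  assert (Hb2 : (-(829/1000) <= alpha2 <= 829/1000)%R) by lra.
  assert (Hb : (-(829/1000) <= t * alpha1 + (1 - t) * alpha2 <= 829/1000)%R) by nra.
  clear Ha1 Ha2 Hsq.
  set (F1 := fun z => h1 z + g1 z) in *. set (F2 := fun z => h2 z + g2 z) in *.
  set (K1 := fun z => h1 z - g1 z). set (K2 := fun z => h2 z - g2 z).
  set (F := fun z => t * F1 z + (1 - t)%R * F2 z).
  set (K := fun z => t * K1 z + (1 - t)%R * K2 z).
  assert (AF1 : analytic_on_disc F1) by (apply analytic_plus; assumption).
  assert (AF2 : analytic_on_disc F2) by (apply analytic_plus; assumption).
  assert (AK1 : analytic_on_disc K1) by (apply analytic_minus; assumption).
  assert (AK2 : analytic_on_disc K2) by (apply analytic_minus; assumption).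
  assert (AF : analytic_on_disc F) by (apply analytic_Ccomb; assumption).
  assert (AK : analytic_on_disc K) by (apply analytic_Ccomb; assumption).
  assert (Ef : f = fun z => (Re (F z), Im (K z))).
  { apply functional_extensionality. intros z.
    unfold f, F, K, F1, F2, K1, K2, harmonic_map.
    destruct (h1 z), (g1 z), (h2 z), (g2 z). apply injective_projections; simpl; ring. }
  (* In terms of [u] the dilatations are [-u] and [u^2], and the variable [v] of the kernel is
     [u^2]. *)
  set (u := fun z : C => z ^ (2 ^ (n - 2))).
  assert (Eu : forall z : C, z ^ (2 ^ (n - 1)) = u z ^ 2).
  { intros z. unfold u. rewrite <- Cpow_mult_r. f_equal.
    replace (n - 1)%nat with (S (n - 2)) by lia. rewrite Nat.pow_succ_r'. lia. }
  assert (Hu : forall z, Defs.disc z -> (Cmod (u z) < 1)%R).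
  { intros z Hz. apply Cmod_pow_lt_1; [apply pow_2_pos|exact Hz]. }
  assert (DF1 : forall z, Defs.disc z -> C_derive F1 z = (1 - u z) * C_derive h1 z).
  { intros z Hz. unfold F1. rewrite C_derive_plus, Hd1 by assumption. fold (u z). ring. }
  assert (DK1 : forall z, Defs.disc z -> C_derive K1 z = (1 + u z) * C_derive h1 z).
  { intros z Hz. unfold K1. rewrite C_derive_minus, Hd1 by assumption. fold (u z). ring. }
  assert (DF2 : forall z, Defs.disc z -> C_derive F2 z = (1 + u z ^ 2) * C_derive h2 z).
  { intros z Hz. unfold F2. rewrite C_derive_plus, Hd2, Eu by assumption. ring. }
  assert (DK2 : forall z, Defs.disc z -> C_derive K2 z = (1 - u z ^ 2) * C_derive h2 z).
  { intros z Hz. unfold K2. rewrite C_derive_minus, Hd2, Eu by assumption. ring. }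
  assert (H0 : Defs.disc 0) by (unfold Defs.disc; rewrite Cmod_0; lra).
  assert (U0 : u 0 = 0).
  { unfold u. assert (H := pow_2_pos (n - 2)). destruct (2 ^ (n - 2))%nat; [lia|]. simpl. ring. }
  assert (NF1 : C_derive F1 0 = 1) by (rewrite DF1, U0, Nh1 by exact H0; ring).
  assert (NF2 : C_derive F2 0 = 1) by (rewrite DF2, U0, Nh2 by exact H0; ring).
  assert (NK1 : C_derive K1 0 = 1) by (rewrite DK1, U0, Nh1 by exact H0; ring).
  assert (NK2 : C_derive K2 0 = 1) by (rewrite DK2, U0, Nh2 by exact H0; ring).
  assert (L1 : forall z, Defs.disc z -> (1 - z ^ 2) * C_derive F1 z = half_plane_kernel n alpha1 z).
  { intros z Hz. apply hadamard_derivative; assumption. }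
  assert (L2 : forall z, Defs.disc z -> (1 - z ^ 2) * C_derive F2 z = half_plane_kernel n alpha2 z).
  { intros z Hz. apply hadamard_derivative; assumption. }
  assert (DF : forall z, Defs.disc z -> C_derive F z = t * C_derive F1 z + (1 - t)%R * C_derive F2 z).
  { intros z Hz. apply C_derive_Ccomb; assumption. }
  assert (DK : forall z, Defs.disc z -> C_derive K z = t * C_derive K1 z + (1 - t)%R * C_derive K2 z).
  { intros z Hz. apply C_derive_Ccomb; assumption. }
  assert (L : forall z, Defs.disc z ->
    (1 - z ^ 2) * C_derive F z = half_plane_kernel n (t * alpha1 + (1 - t) * alpha2)%R z).
  { intros z Hz. rewrite <- half_plane_kernel_comb, <- L1, <- L2, DF by assumption. ring. }
  assert (HJ : forall z, Defs.disc z -> (0 < Re (C_derive K z * Cconj (C_derive F z)))%R).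
  { intros z Hz. rewrite DF, DK, DF1, DF2, DK1, DK2, jacobian_comb by exact Hz.
    assert (Hcross : (0 <= Re (C_derive h1 z * Cconj (C_derive h2 z) *
      (1 + (Cmod (u z) ^ 2)%R * Cconj (u z))))%R).
    { assert (Hz2 : 1 - z ^ 2 <> 0) by (apply Cminus_1_neq_0, Cmod_pow_lt_1; [lia|exact Hz]).
      assert (Hu8 : 1 + (u z ^ 2) ^ 4 <> 0).
      { apply Cplus_1_neq_0. do 2 (apply Cmod_pow_lt_1; [lia|]). apply Hu, Hz. }
      (* With [v = u^2] both [F1'] and [F2'] contain the factor [(1 - u^4) / ((1 + u^8) (1 - z^2))];
         they differ only in [1 + u^4 + alpha u^2]. *)
      apply (jacobian_cross_term (u z) _ _
        ((1 - u z ^ 4) / ((1 + (u z ^ 2) ^ 4) * (1 - z ^ 2))) alpha1 alpha2); try lra.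
      - apply Hu, Hz.
      - rewrite <- DF1 by exact Hz.
        transitivity ((1 - z ^ 2) * C_derive F1 z / (1 - z ^ 2)); [field; exact Hz2|].
        rewrite L1 by exact Hz. unfold half_plane_kernel. rewrite Eu.
        field. split; assumption.
      - rewrite <- DF2 by exact Hz.
        transitivity ((1 - z ^ 2) * C_derive F2 z / (1 - z ^ 2)); [field; exact Hz2|].
        rewrite L2 by exact Hz. unfold half_plane_kernel. rewrite Eu.
        field. split; assumption. }
    (* A zero of [h1'] would be a zero of [F1'], against the positive real part of
       [(1 - z^2) F1']. *)
    assert (Hnz1 : C_derive h1 z <> 0).
    { intros E. assert (P1 := half_plane_kernel_pos n alpha1 z Hb1 Hz).
      rewrite <- L1, DF1, E in P1 by exact Hz. rewrite !Cmult_0_r in P1. simpl in P1. lra. }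
    assert (Hnz2 : C_derive h2 z <> 0).
    { intros E. assert (P2 := half_plane_kernel_pos n alpha2 z Hb2 Hz).
      rewrite <- L2, DF2, E in P2 by exact Hz. rewrite !Cmult_0_r in P2. simpl in P2. lra. }
    apply Cmod_gt_0 in Hnz1. apply Cmod_gt_0 in Hnz2.
    specialize (Hu z Hz). assert (Hu0 := Cmod_ge_0 (u z)).
    set (r := (Cmod (u z) ^ 2)%R) in *.
    assert (Hr : (0 <= r < 1)%R) by (unfold r; split; nra).
    assert (P1 : (0 < Cmod (C_derive h1 z) ^ 2 * (1 - r))%R).
    { apply Rmult_lt_0_compat; [apply pow_lt, Hnz1|lra]. }
    assert (P2 : (0 < Cmod (C_derive h2 z) ^ 2 * (1 - r ^ 2))%R).
    { apply Rmult_lt_0_compat; [apply pow_lt, Hnz2|nra]. }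
    set (p1 := (Cmod (C_derive h1 z) ^ 2 * (1 - r))%R) in *.
    set (p2 := (Cmod (C_derive h2 z) ^ 2 * (1 - r ^ 2))%R) in *.
    rewrite (Rmult_assoc (t ^ 2)), (Rmult_assoc ((1 - t) ^ 2)). fold p1 p2.
    assert (0 <= 2 * t * (1 - t) * Re (C_derive h1 z * Cconj (C_derive h2 z) *
      (1 + r * Cconj (u z))))%R.
    { apply Rmult_le_pos; [|exact Hcross]. apply Rmult_le_pos; lra. }
    assert (0 < t ^ 2 * p1 + (1 - t) ^ 2 * p2)%R; [|lra].
    (* Strictness comes from the first square term if [t > 0] and from the second if [t = 0]. *)
    destruct (Rlt_dec 0 t) as [Htp|Htp].
    - assert (0 < t ^ 2 * p1)%R by (apply Rmult_lt_0_compat; [apply pow_lt|]; assumption).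
      assert (0 <= (1 - t) ^ 2 * p2)%R by (apply Rmult_le_pos; [apply pow2_ge_0|lra]). lra.
    - replace t with 0%R by lra. lra. }
  assert (HC : convex_in_imaginary_direction f).
  { rewrite Ef. apply shear_convex_imaginary; try assumption.
    - intros z Hz. rewrite L by exact Hz. apply half_plane_kernel_pos; assumption.
    - intros e He. destruct (half_plane_kernel_limit n _ e Hn Hb He) as (d & Hd & H).
      exists d. split; [exact Hd|]. intros z Hz Hzd. rewrite L by exact Hz. apply H; assumption. }
  split; [|exact HC].
  destruct HC as [Huni _]. rewrite Ef in Huni |- *.
  apply S_H_of_shear; try assumption.
  - unfold F, F1, F2. rewrite Zh1, Zg1, Zh2, Zg2. ring.
  - unfold K, K1, K2. rewrite Zh1, Zg1, Zh2, Zg2. ring.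
  - rewrite DF, NF1, NF2, RtoC_minus by exact H0. ring.
  - rewrite DK, NK1, NK2, RtoC_minus by exact H0. ring.
Qed.
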